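(* Let $\Delta$ be a spectrally elliptic operator with heat spectrum $\{s_0, s_0-1, s_0-2, \dots\}$, let $s_1 = s_0-1$, and let $\epsilon(\Lambda) = 2\log\Lambda/\Lambda$. Then $$\operatorname{res}_{s=s_1} \big(\zeta(\Delta,s)\,\Gamma(s)\big) = \lim_{\Lambda\to\infty} \frac{\epsilon(\Lambda)^{s_0-1}}{e\,\Gamma(2-s_0,1)} \operatorname{tr}_\Lambda\left( \frac{2^{s_0}e^{-2\Delta\epsilon(\Lambda)}}{1+2\Delta\epsilon(\Lambda)} - \frac{e^{-\Delta\epsilon(\Lambda)}}{1+\Delta\epsilon(\Lambda)}\right).$$
   Context: A positive, invertible, self-adjoint, unbounded operator $\Delta$ with compact resolvent on a Hilbert space is called spectrally elliptic if $\operatorname{tr} e^{-t\Delta}$ admits an asymptotic expansion $\sum_{i=0}^\infty c_i t^{-s_i}$ as $t \to 0^+$, where the $s_i$ are decreasingly ordered reals. The set of exponents $s_i$ is called the heat spectrum of $\Delta$. The function $\zeta(\Delta,s)$ denotes $\operatorname{tr}\Delta^{-s}$ (convergent for $\operatorname{Re} s$ large), and $\Gamma(s)\zeta(\Delta,s)$ is understood as its meromorphic continuation; $\operatorname{res}_{s=a}$ is the residue at $s=a$ (zero if there is no pole). $\Gamma(a,x) = \int_x^\infty t^{a-1}e^{-t}\,dt$ is the upper incomplete Gamma function. $\sigma(\Delta)$ is the spectrum of $\Delta$, consisting of eigenvalues, counted with multiplicities, and for a Borel measurable function $G$, $\operatorname{tr}_\Lambda G(\Delta) = \sum_{\lambda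 \in \sigma(\Delta)\cap(0,\Lambda]} G(\lambda)$. *)

(* Defs.v *)
From HB Require Import structures.
From mathcomp Require Export all_boot all_order all_algebra.
From mathcomp Require Export complex.
From mathcomp Require Export all_classical all_reals all_analysis.

Set Implicit Arguments.
Unset Strict Implicit.
Unset Printing Implicit Defensive.

Import Order.TTheory GRing.Theory Num.Theory.
Import numFieldNormedType.Exports.

Local Open Scope classical_set_scope.
Local Open Scope ring_scope.
Local Open Scope complex_scope.

Section HilbertOperators.
Variables (R : realType) (H : completeNormedModType R[i]).

(* A Hilbert space is a complete normed space whose norm comes from an inner
   product; [{dot H for conjC}] is linear in its first argument. *)
Definition is_inner_product (ip : {dot H for @Num.conj R[i]}) : Prop :=
  forall x : H, ip x x = `|x| ^+ 2.

(* The values of [op] outside [dom] are irrelevant. *)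
Record operator := Operator {
  dom : set H;
  op : H -> H;
  dom0 : dom 0;
  dom_linear : forall (a : R[i]) x y, dom x -> dom y -> dom (a *: x + y);
  dom_dense : dense dom;
  op_linear : forall (a : R[i]) x y, dom x -> dom y ->
    op (a *: x + y) = a *: op x + op y }.

Implicit Types (D : operator) (S : H -> H) (z : R[i]) (l : R).

Definition bounded_op S : Prop := exists M : R[i], forall x, `|S x| <= M * `|x|.

Definition unbounded D : Prop :=
  ~ exists M : R[i], forall x, dom D x -> `|op D x| <= M * `|x|.

(* The right-hand side says that y is in the domain of D and D y = z; the
   left-hand side says the same for the adjoint of D. *)
Definition self_adjoint (ip : {dot H for @Num.conj R[i]}) D : Prop :=
  forall y z : H,
    (forall x, dom D x -> ip (op D x) y = ip x z) <-> (dom D y /\ op D y = z).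

Definition positive (ip : {dot H for @Num.conj R[i]}) D : Prop :=
  forall x, dom D x -> 0 <= ip (op D x) x.

(* S is the bounded inverse of D - z. *)
Definition is_resolvent D z S : Prop :=
  [/\ forall x, dom D (S x) /\ op D (S x) - z *: S x = x,
      forall x, dom D x -> S (op D x - z *: x) = x
    & bounded_op S].

Definition invertible D : Prop := exists S, is_resolvent D 0 S.

Definition compact_op S : Prop := precompact (S @` [set x | `|x| <= 1]).

Definition compact_resolvent D : Prop :=
  exists z S, is_resolvent D z S /\ compact_op S.

Definition spectrum D : set R[i] := [set z | ~ exists S, is_resolvent D z S].

(* The spectrum of a self-adjoint operator is real, so that nothing is lost. *)
Definition real_spectrum D : set R := [set l | spectrum D l%:C].

Definition eigenspace D l : set H := [set x | dom D x /\ op D x = l%:C *: x].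

Definition has_dim (E : set H) (n : nat) : Prop :=
  exists e : 'I_n -> H,
    E = [set x | exists a : 'I_n -> R[i], x = \sum_i a i *: e i] /\
    (forall a : 'I_n -> R[i], \sum_i a i *: e i = 0 -> forall i, a i = 0).

(* Eigenspaces are finite-dimensional when the resolvent is compact; the
   default value 0 is never used for such operators. *)
Definition multiplicity D l : nat := xget 0%N (has_dim (eigenspace D l)).

(* Traces of functions of D are sums over the spectrum, which consists of
   eigenvalues, counted with multiplicities. *)
Definition trace_class D (G : R -> R) : Prop :=
  summable (real_spectrum D) (fun l => ((multiplicity D l)%:R * G l)%:E).

Definition trace D (G : R -> R) : R :=
  fine (\esum_(l in real_spectrum D)
          ((multiplicity D l)%:R * Num.max (G l) 0)%:E) -
  fine (\esum_(l in real_spectrum D)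
          ((multiplicity D l)%:R * Num.max (- G l) 0)%:E).

Definition ctrace_class D (G : R -> R[i]) : Prop :=
  trace_class D (fun l => complex.Re (G l)) /\
  trace_class D (fun l => complex.Im (G l)).

Definition ctrace D (G : R -> R[i]) : R[i] :=
  trace D (fun l => complex.Re (G l)) +i* trace D (fun l => complex.Im (G l)).

(* A finite sum, as the eigenvalues in ]0, L] are finitely many. *)
Definition trace_upto D (L : R) (G : R -> R) : R :=
  \sum_(l \in real_spectrum D `&` `]0, L]%classic) (multiplicity D l)%:R * G l.

Definition heat_trace D (t : R) : R := trace D (fun l => expR (- t * l)).

(* Poincare asymptotic expansion of the heat trace as t -> 0+; the
   coefficients c i are allowed to vanish. *)
Definition heat_expansion D (s c : nat -> R) : Prop :=
  [/\ forall t, 0 < t -> trace_class D (fun l => expR (- t * l)),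
      forall i j, (i < j)%N -> s j < s i
    & forall n,
        (heat_trace D t - \sum_(i < n.+1) c i * t `^ (- s i)) / t `^ (- s n)
          @[t --> 0^'+] --> 0].

Definition spectrally_elliptic (ip : {dot H for @Num.conj R[i]}) D : Prop :=
  [/\ [/\ self_adjoint ip D, positive ip D & invertible D],
      unbounded D, compact_resolvent D
    & exists s c, heat_expansion D s c].

Definition heat_spectrum D (E : set R) : Prop :=
  exists s c, heat_expansion D s c /\ E = range s.

End HilbertOperators.

Section ComplexFunctions.
Variable R : realType.
Implicit Types (F : R[i] -> R[i]) (z a s : R[i]).

Definition cexp z : R[i] :=
  (expR (complex.Re z) * cos (complex.Im z)) +i*
  (expR (complex.Re z) * sin (complex.Im z)).

(* t ^ z for t > 0 *)
Definition cpow (t : R) z : R[i] := cexp (z * (ln t)%:C).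

(* Euler's integral, for Re s > 0 *)
Definition cGamma s : R[i] :=
  let f t := cpow t (s - 1) * (expR (- t))%:C in
  (\int[lebesgue_measure]_(t in `]0%R, +oo[) complex.Re (f t)) +i*
  (\int[lebesgue_measure]_(t in `]0%R, +oo[) complex.Im (f t)).

Definition upper_Gamma (a x : R) : R :=
  \int[lebesgue_measure]_(t in `[x, +oo[) (t `^ (a - 1) * expR (- t)).

(* The codomain and domain are taken as the normed module R[i]^o over R[i], so
   this is complex differentiability. *)
Definition holomorphic_near F a : Prop :=
  \forall w \near (a : R[i]^o), derivable (F : R[i]^o -> R[i]^o) w 1.

Definition meromorphic F : Prop :=
  forall a, exists n (g : R[i] -> R[i]), holomorphic_near g a /\
    \forall w \near (a : R[i]^o)^', F w = g w / (w - a) ^+ n.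

(* c is the coefficient of (w - a)^-1 in the Laurent expansion of F at a; it is
   0 when F has no pole at a. *)
Definition is_residue F a (c : R[i]) : Prop :=
  exists n (b : nat -> R[i]) (h : R[i] -> R[i]),
    [/\ holomorphic_near h a,
        \forall w \near (a : R[i]^o)^',
          F w = h w + \sum_(k < n.+1) b k / (w - a) ^+ k.+1
      & b 0%N = c].

End ComplexFunctions.

Section Zeta.
Variables (R : realType) (H : completeNormedModType R[i]).
Implicit Types (D : operator H) (s : R[i]).

Definition zeta_cvg D s : Prop := ctrace_class D (fun l => cpow l (- s)).

Definition zeta D s : R[i] := ctrace D (fun l => cpow l (- s)).

(* F is the meromorphic continuation to the whole plane of the function
   zeta(D, s) Gamma(s), given by its defining formulas for Re s large; F is
   unique up to its values on a discrete set. *)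
Definition zeta_Gamma_continuation D (F : R[i] -> R[i]) : Prop :=
  meromorphic F /\
  exists2 x0 : R, 0 <= x0 & forall s, x0 < complex.Re s ->
    zeta_cvg D s /\ F s = zeta D s * cGamma s.

End Zeta.

Definition epsilon (R : realType) (L : R) : R := 2 * ln L / L.

(* Main.v *)
Require Import Defs.
From HB Require Import structures.
From mathcomp Require Import ring lra measurable_realfun.
Import Order.TTheory GRing.Theory Num.Theory.
Import numFieldNormedType.Exports.
Local Open Scope classical_set_scope.
Local Open Scope ring_scope.
Local Open Scope complex_scope.
Set Implicit Arguments.
Unset Strict Implicit.
Unset Printing Implicit Defensive.

(** Write [Z t] for the heat trace and [c i] for the coefficients of its
    expansion; the exponents are [s i = s0 - i] ([decreasing_enumeration]).

    Everything depends only on the eigenvalues.  An eigenvector with eigenvalue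
    [l] gives [l >= 0] by positivity and [l <> 0] by invertibility
    ([eigenvalue_gt0]), and convergence of the heat trace leaves finitely many
    eigenvalues below any bound.  So there is a least eigenvalue [a > 0], and
    traces are series over an enumeration of the spectrum
    ([spectrum_enumeration], [trace_series]); in particular [Z] decays like
    [expR (- a * t)].

    Continuation and residue.  For [Re z > s0], integrating the series of [Z]
    term by term turns zeta times Gamma into the integral of
    [t ^ (z - 1) * Z t] over the half-line ([zeta_Gamma_mellin]).  The part over
    [t >= 1] is entire.  Over [0 < t <= 1], subtract the first [n] terms of the
    expansion: each of them integrates to [c i / (z - s i)], and the remainder,
    which is O of [t ^ (- s n)], gives a function holomorphic for [Re z > s n]
    ([derivable_mellin], [mellin_remS]).  These formulas agree where they
    overlap ([heat_cont_irr]), so together they define a meromorphic function on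
    the plane, with simple poles and residue [c i] at [s i]
    ([residue_heat_continuation]).  The residue at [s1] is therefore [c 1].

    The limit.  The function [g y = expR (- y) / (1 + y)] is [e] times the
    integral of [expR (- u) * expR (- u * y)] over [u >= 1], hence the trace of
    [g] at [x] times the operator is [e] times the integral of
    [expR (- u) * Z (x * u)] ([series_cutoff]).  In
    [2 ^ s0 * Z (2 * t) - Z t] the term with coefficient [c 0] cancels, and
    after multiplication by [t ^ (s0 - 1)] it tends to [c 1]
    ([balanced_cvg]) and stays bounded ([balanced_bounded]).  By dominated
    convergence the trace over the whole spectrum, scaled by [x ^ (s0 - 1)],
    tends to [c 1] times [e] times the integral of [u ^ (1 - s0) * expR (- u)]
    over [u >= 1], that is [c 1 * e * Gamma (2 - s0, 1)]
    ([cutoff_pair_limit]).  Finally, for [x = epsilon L], half of the exponent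
    of [expR (- x * l)] is at least [ln L] when [l > L], so the eigenvalues
    beyond [L] contribute at most a constant times [Z (x / 2) / L], which after
    scaling is O of [1 / ln L] ([tail_bound], [truncated_limit]). *)

Local Notation Re := complex.Re.
Local Notation Im := complex.Im.

(** * The complex exponential *)

Section ComplexExponential.
Variable R : realType.
Implicit Types (x y p q u v : R) (z w h : R[i]).

Definition modulus z : R := Num.sqrt (Re z ^+ 2 + Im z ^+ 2).

Lemma normcE z : `|z| = (modulus z)%:C.
Proof. by rewrite normc_def. Qed.

Lemma cReD z w : Re (z + w) = Re z + Re w. Proof. by case: z w => ? ? []. Qed.
Lemma cImD z w : Im (z + w) = Im z + Im w. Proof. by case: z w => ? ? []. Qed.
Lemma cReN z : Re (- z) = - Re z. Proof. by case: z. Qed.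
Lemma cImN z : Im (- z) = - Im z. Proof. by case: z. Qed.
Lemma cReM z w : Re (z * w) = Re z * Re w - Im z * Im w.
Proof. by case: z w => ? ? []. Qed.
Lemma cImM z w : Im (z * w) = Re z * Im w + Im z * Re w.
Proof. by case: z w => ? ? []. Qed.

Lemma cReMr z x : Re (z * x%:C) = Re z * x.
Proof. by rewrite cReM /= mulr0 subr0. Qed.

Lemma cImMr z x : Im (z * x%:C) = Im z * x.
Proof. by rewrite cImM /= mulr0 add0r. Qed.

Definition ReImE := (cReD, cImD, cReN, cImN, cReM, cImM).

Lemma complex_eqP z w : Re z = Re w -> Im z = Im w -> z = w.
Proof. by case: z w => a b [c d] /= -> ->. Qed.

Lemma Re_le_modulus z : `|Re z| <= modulus z.
Proof. by rewrite -sqrtr_sqr ler_wsqrtr// lerDl sqr_ge0. Qed.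

Lemma Im_le_modulus z : `|Im z| <= modulus z.
Proof. by rewrite -sqrtr_sqr ler_wsqrtr// lerDr sqr_ge0. Qed.

Lemma modulus_ge0 z : 0 <= modulus z. Proof. exact: sqrtr_ge0. Qed.

Lemma modulus_le z : modulus z <= `|Re z| + `|Im z|.
Proof.
rewrite -[leRHS]ger0_norm ?addr_ge0// -sqrtr_sqr ler_wsqrtr//.
rewrite -(real_normK (num_real (Re z))) -(real_normK (num_real (Im z))).
have := normr_ge0 (Re z); have := normr_ge0 (Im z).
by move: (`|Re z|) (`|Im z|) => a b; nra.
Qed.

Lemma cexpD z w : cexp (z + w) = cexp z * cexp w.
Proof.
apply: complex_eqP; rewrite /cexp !ReImE /= expRD ?cosD ?sinD; ring.
Qed.

Lemma cexp0 : cexp (0 : R[i]) = 1.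
Proof. by rewrite /cexp/= expR0 cos0 sin0 mulr1 mulr0. Qed.

Lemma cexpN z : cexp (- z) * cexp z = 1.
Proof. by rewrite -cexpD addNr cexp0. Qed.

Lemma cexp_real x : cexp x%:C = (expR x)%:C.
Proof. by rewrite /cexp/= cos0 sin0 mulr1 mulr0. Qed.

Lemma Re_cexp_le z : `|Re (cexp z)| <= expR (Re z).
Proof.
rewrite /cexp/= normrM ger0_norm ?expR_ge0// ler_piMr ?expR_ge0//.
by rewrite ler_norml cos_geN1 cos_le1.
Qed.

Lemma Im_cexp_le z : `|Im (cexp z)| <= expR (Re z).
Proof.
rewrite /cexp/= normrM ger0_norm ?expR_ge0// ler_piMr ?expR_ge0//.
by rewrite ler_norml sin_geN1 sin_le1.
Qed.

Lemma normr_sin_le x : `|sin x| <= `|x|.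
Proof.
wlog x0 : x / 0 <= x.
  move=> wl; have [/wl//|/ltW] := leP 0 x.
  by rewrite -oppr_ge0 => /wl; rewrite sinN !normrN.
have cs : {within `[0, x], continuous (@sin R)}.
  exact/continuous_subspaceT/continuous_sin.
have [c _] := MVT_segment x0 (fun y _ => is_derive_sin y) cs.
rewrite sin0 !subr0 => ->; rewrite normrM ler_piMl//.
by rewrite ler_norml cos_geN1 cos_le1.
Qed.

Lemma cosB1E x : cos x - 1 = - ((sin (x / 2)) ^+ 2 *+ 2).
Proof.
rewrite [X in cos X](_ : x = (x / 2) *+ 2); last by rewrite mulr2n; field.
by rewrite cos_mulr2n cos2sin2; ring.
Qed.

Lemma cosB1_le x : `|cos x - 1| <= `|x|.
Proof.
rewrite cosB1E normrN normrMn normrX mulr2n.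
have h := normr_sin_le (x / 2).
have h1 : `|sin (x / 2)| <= 1 by rewrite ler_norml sin_geN1 sin_le1.
have e : `|x / 2| = `|x| / 2 by rewrite normrM [`|2^-1|]ger0_norm.
rewrite e in h; have := normr_ge0 (sin (x / 2)).
by move: (`|sin _|) (`|x|) h h1 => a b; nra.
Qed.

Lemma cosB1_le2 x : `|cos x - 1| <= x ^+ 2.
Proof.
rewrite cosB1E normrN normrMn normrX mulr2n -(real_normK (num_real x)).
have h := normr_sin_le (x / 2).
have e : `|x / 2| = `|x| / 2 by rewrite normrM [`|2^-1|]ger0_norm.
rewrite e in h; have := normr_ge0 (sin (x / 2)).
by move: (`|sin _|) (`|x|) h => a b; nra.
Qed.

Lemma sinB_le x : `|sin x - x| <= x ^+ 2.
Proof.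
wlog x0 : x / 0 <= x.
  move=> wl; have [/wl//|/ltW] := leP 0 x.
  by rewrite -oppr_ge0 => /wl; rewrite sinN -opprD normrN sqrrN.
have cs : {within `[0, x], continuous (@sin R \- id)}.
  apply: continuous_subspaceT => y; apply: continuousB => //.
  exact: continuous_sin.
have [c] := MVT_segment x0 (fun y _ => is_deriveB (is_derive_sin y)
  (is_derive_id _ _)) cs.
rewrite in_itv/= => /andP[c0 cx].
rewrite !fctE sin0 !subr0 => ->; rewrite normrM (ger0_norm x0) expr2 ler_wpM2r//.
by rewrite (le_trans (cosB1_le _))// ger0_norm.
Qed.

Lemma expRB1_le p : `|expR p - 1| <= `|p| * expR `|p|.
Proof.
have h1 := expR_ge1Dx p; have h2 := expR_ge1Dx (- p).
have h3 : expR p - 1 <= p * expR p.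
  have := expR_gt0 p => e0.
  have : expR (- p) * expR p = 1 by rewrite -expRD addNr expR0.
  nra.
have [p0|p0] := leP 0 p.
  rewrite ger0_norm; last by lra.
  by rewrite (ger0_norm p0).
have : 1 <= expR `|p| by rewrite -expR0 ler_expR.
have : expR p <= 1 by rewrite -expR0 ler_expR ltW.
rewrite (ltr0_norm p0) => h4 h5.
rewrite ler0_norm; last by lra.
nra.
Qed.

Lemma expRB1D_le p : `|expR p - 1 - p| <= p ^+ 2 * expR `|p|.
Proof.
have h1 := expR_ge1Dx p.
have h2 := expRB1_le p.
rewrite ger0_norm; last by lra.
have h3 : expR p - 1 <= p * expR p.
  have e0 := expR_gt0 p; have := expR_ge1Dx (- p).
  have : expR (- p) * expR p = 1 by rewrite -expRD addNr expR0.
  nra.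
apply: (@le_trans _ _ (p * (expR p - 1))); first by lra.
apply: (le_trans (ler_norm _)); rewrite normrM.
rewrite -(real_normK (num_real p)) expr2 -mulrA.
by rewrite ler_wpM2l.
Qed.

(** Second-order Taylor bound, stated along a ray so that it can be integrated
    in [u]; the factor [expR v] makes it uniform in [u]. *)
Lemma cexp_taylor h u v : modulus h * `|u| <= v ->
  let k := cexp (h * u%:C) - 1 - h * u%:C in
  `|Re k| <= 2 * v ^+ 2 * expR v /\ `|Im k| <= 2 * v ^+ 2 * expR v.
Proof.
move=> hv k.
set p := Re h * u; set q := Im h * u.
have pv : `|p| <= v.
  by apply: le_trans hv; rewrite normrM ler_wpM2r// Re_le_modulus.
have qv : `|q| <= v.
  by apply: le_trans hv; rewrite normrM ler_wpM2r// Im_le_modulus.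
have ev : 1 <= expR v by rewrite -expR0 ler_expR (le_trans _ pv).
have pv2 : p ^+ 2 <= v ^+ 2.
  by rewrite -(real_normK (num_real p)) lerXn2r// nnegrE (le_trans _ pv).
have qv2 : q ^+ 2 <= v ^+ 2.
  by rewrite -(real_normK (num_real q)) lerXn2r// nnegrE (le_trans _ qv).
have epv : expR `|p| <= expR v by rewrite ler_expR.
have ep : expR p <= expR v by rewrite ler_expR (le_trans (ler_norm _)).
have v0 : 0 <= v ^+ 2 by exact: sqr_ge0.
have Rk : Re k = expR p * (cos q - 1) + (expR p - 1 - p).
  rewrite /k /cexp !ReImE /= !mulr0 subr0 add0r -/p -/q; ring.
have Ik : Im k = (expR p - 1) * sin q + (sin q - q).
  rewrite /k /cexp !ReImE /= !mulr0 !subr0 add0r -/p -/q; ring.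
rewrite Rk Ik; split; apply: (le_trans (ler_normD _ _)); rewrite normrM.
- have := expRB1D_le p; have := cosB1_le2 q.
  rewrite [`|expR p|]ger0_norm ?expR_ge0// => h1 h2.
  have := expR_gt0 p; have := normr_ge0 (cos q - 1).
  have := sqr_ge0 p; have := sqr_ge0 q; have := expR_gt0 `|p|.
  move: (`|cos q - 1|) (expR p) (p ^+ 2) (q ^+ 2) (`|expR _ - _ - _|) ep h1 h2 epv pv2 qv2.
  move=> a b c d e *.
  have : b * a <= expR v * v ^+ 2 by nra.
  have : c * expR `|p| <= v ^+ 2 * expR v by nra.
  by lra.
- have := sinB_le q; have := normr_sin_le q; have := expRB1_le p => h1 h2 h3.
  have a0 := normr_ge0 (expR p - 1); have b0 := normr_ge0 (sin q).
  have p0 := normr_ge0 p; have q0 := normr_ge0 q.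
  have : `|expR p - 1| <= v * expR v.
    by apply: (le_trans h1); rewrite ler_pM// expR_ge0.
  have : `|sin q| <= v by exact: le_trans qv.
  move: (`|expR p - 1|) (`|sin q|) (`|sin q - q|) a0 b0 h3 => a b c *.
  have : a * b <= v * expR v * v by rewrite ler_pM.
  nra.
Qed.

End ComplexExponential.

(** * Integrals of complex functions *)

Section ComplexIntegral.
Context d (T : measurableType d) (R : realType) (mu : {measure set T -> \bar R}).
Implicit Types (D : set T) (f g : T -> R[i]) (phi : T -> R).

Definition Cmeasurable D f :=
  measurable_fun D (fun t => Re (f t)) /\ measurable_fun D (fun t => Im (f t)).

Definition Cintegrable D f :=
  mu.-integrable D (EFin \o (fun t => Re (f t))) /\
  mu.-integrable D (EFin \o (fun t => Im (f t))).

(** Componentwise, so that [cGamma] is an instance by conversion. *)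
Definition Cintegral D f : R[i] :=
  (\int[mu]_(t in D) Re (f t)) +i* (\int[mu]_(t in D) Im (f t)).

Lemma eq_Cintegral D f g : {in D, f =1 g} -> Cintegral D f = Cintegral D g.
Proof.
by move=> fg; congr Complex; apply: eq_Rintegral => t tD; rewrite fg.
Qed.

Lemma CmeasurableM D f g : measurable D -> Cmeasurable D f -> Cmeasurable D g ->
  Cmeasurable D (fun t => f t * g t).
Proof.
move=> mD [f1 f2] [g1 g2]; split.
  under eq_fun do rewrite cReM.
  by apply: measurable_funB; apply: measurable_funM.
under eq_fun do rewrite cImM.
by apply: measurable_funD; apply: measurable_funM.
Qed.

Lemma Cmeasurable_cexp D f : measurable D -> Cmeasurable D f ->
  Cmeasurable D (fun t => cexp (f t)).
Proof.
have mcos : measurable_fun setT (@cos R).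
  by apply: continuous_measurable_fun; exact: continuous_cos.
have msin : measurable_fun setT (@sin R).
  by apply: continuous_measurable_fun; exact: continuous_sin.
move=> mD [f1 f2]; split; rewrite /cexp /=; apply: measurable_funM;
  exact: measurableT_comp.
Qed.

Lemma Cmeasurable_cexpM D z phi : measurable D -> measurable_fun D phi ->
  Cmeasurable D (fun t => cexp (z * (phi t)%:C)).
Proof.
move=> mD mphi; apply: Cmeasurable_cexp => //; apply: CmeasurableM => //.
Qed.

Lemma CintegrableZ D z f : measurable D -> Cintegrable D f ->
  Cintegrable D (fun t => z * f t).
Proof.
move=> mD [f1 f2]; split.
  under eq_fun do rewrite cReM.
  rewrite [X in integrable _ _ X](_ : _ = (fun t => (Re z)%:E * (Re (f t))%:E)
     \- (fun t => (Im z)%:E * (Im (f t))%:E))%E//.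
  by apply: integrableB => //; exact: integrableZl.
under eq_fun do rewrite cImM.
rewrite [X in integrable _ _ X](_ : _ = (fun t => (Re z)%:E * (Im (f t))%:E)
   \+ (fun t => (Im z)%:E * (Re (f t))%:E))%E//.
by apply: integrableD => //; exact: integrableZl.
Qed.

Lemma CintegrableD D f g : measurable D -> Cintegrable D f -> Cintegrable D g ->
  Cintegrable D (fun t => f t + g t).
Proof.
move=> mD [f1 f2] [g1 g2]; split.
  under eq_fun do rewrite cReD.
  exact: (integrableD mD f1 g1).
under eq_fun do rewrite cImD.
exact: (integrableD mD f2 g2).
Qed.

Lemma CintegralD D f g : measurable D -> Cintegrable D f -> Cintegrable D g ->
  Cintegral D (fun t => f t + g t) = Cintegral D f + Cintegral D g.
Proof.
move=> mD [f1 f2] [g1 g2]; apply: complex_eqP; rewrite ?cReD ?cImD /=.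
  by under eq_Rintegral do rewrite cReD; rewrite RintegralD.
by under eq_Rintegral do rewrite cImD; rewrite RintegralD.
Qed.

Lemma CintegralZ D z f : measurable D -> Cintegrable D f ->
  Cintegral D (fun t => z * f t) = z * Cintegral D f.
Proof.
move=> mD [f1 f2].
have h (r : R) (phi : T -> R) : mu.-integrable D (EFin \o phi) ->
    mu.-integrable D (EFin \o (fun t => r * phi t)).
  move=> hphi; rewrite [X in integrable _ _ X](_ : _ = (fun t => r%:E * (phi t)%:E)%E)//.
  exact: integrableZl.
apply: complex_eqP; rewrite ?cReM ?cImM /=.
  under eq_Rintegral do rewrite cReM.
  by rewrite RintegralB ?RintegralZl//; exact: h.
under eq_Rintegral do rewrite cImM.
by rewrite RintegralD ?RintegralZl//; exact: h.
Qed.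

Lemma Cintegrable_le D f phi : measurable D -> Cmeasurable D f ->
  mu.-integrable D (EFin \o phi) ->
  (forall t, D t -> `|Re (f t)| <= phi t /\ `|Im (f t)| <= phi t) ->
  Cintegrable D f.
Proof.
move=> mD [f1 f2] iphi le; split.
  apply: (le_integrable mD _ _ iphi); first exact/measurable_EFinP.
  move=> t Dt /=; rewrite lee_fin.
  by rewrite (le_trans (le t Dt).1)// ler_norm.
apply: (le_integrable mD _ _ iphi); first exact/measurable_EFinP.
move=> t Dt /=; rewrite lee_fin.
by rewrite (le_trans (le t Dt).2)// ler_norm.
Qed.

Lemma modulus_Cintegral_le D f phi : measurable D -> Cintegrable D f ->
  mu.-integrable D (EFin \o phi) ->
  (forall t, D t -> `|Re (f t)| <= phi t /\ `|Im (f t)| <= phi t) ->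
  modulus (Cintegral D f) <= 2 * \int[mu]_(t in D) phi t.
Proof.
move=> mD [f1 f2] iphi le.
rewrite (le_trans (modulus_le _))//= mulr_natl mulr2n lerD//.
  rewrite (le_trans (le_normr_Rintegral mD f1))// le_Rintegral//.
    exact: integrable_norm f1.
  by move=> t /le[].
rewrite (le_trans (le_normr_Rintegral mD f2))// le_Rintegral//.
  exact: integrable_norm f2.
by move=> t /le[].
Qed.

End ComplexIntegral.

(** * Holomorphy of Laplace integrals *)

Section Laplace.
Context d (T : measurableType d) (R : realType) (mu : {measure set T -> \bar R}).
Variables (D : set T) (u phi : T -> R).
Hypotheses (mD : measurable D) (mu_ : measurable_fun D u)
  (mphi : measurable_fun D phi).

Definition laplace (z : R[i]) : R[i] :=
  Cintegral mu D (fun t => cexp (z * (u t)%:C) * (phi t)%:C).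

Let weight x := mu.-integrable D (EFin \o (fun t => expR (x * u t) * phi t)).

Lemma Cmeasurable_laplace z :
  Cmeasurable D (fun t => cexp (z * (u t)%:C) * (phi t)%:C).
Proof.
by apply: CmeasurableM => //; exact: Cmeasurable_cexpM.
Qed.

Lemma laplace_bound z t :
  `|Re (cexp (z * (u t)%:C) * (phi t)%:C)| <= `|expR (Re z * u t) * phi t| /\
  `|Im (cexp (z * (u t)%:C) * (phi t)%:C)| <= `|expR (Re z * u t) * phi t|.
Proof.
have e : Re (z * (u t)%:C) = Re z * u t by rewrite cReM /= mulr0 subr0.
have h1 := Re_cexp_le (z * (u t)%:C); have h2 := Im_cexp_le (z * (u t)%:C).
rewrite e in h1 h2; move: (cexp _) h1 h2 => A h1 h2.
rewrite cReM cImM /= !mulr0 subr0 add0r !normrM [`|expR _|]ger0_norm ?expR_ge0//.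
by split; apply: ler_wpM2r.
Qed.

Lemma Cintegrable_laplace z : weight (Re z) ->
  Cintegrable mu D (fun t => cexp (z * (u t)%:C) * (phi t)%:C).
Proof.
move=> wz; have wz' := integrable_norm wz.
apply: (Cintegrable_le mD (Cmeasurable_laplace z) wz') => t _.
exact: laplace_bound.
Qed.

(** Differentiation under the integral sign. The second-order Taylor bound
    controls the difference quotient by the two real weights on either side of
    [Re z]; the spare exponential factor absorbs the powers of [u]. *)
Lemma derivable_laplace a b z :
  (forall x, a < x < b -> weight x) -> a < Re z < b ->
  derivable (laplace : R[i]^o -> R[i]^o) z 1.
Proof.
move=> wab /andP[az zb].
set x := Re z.
(* A third of the distance to the boundary: [2 * del] of slack is spent on the
   increment and on the powers of [u]. *)
pose del := Num.min (x - a) (b - x) / 3.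
have del0 : 0 < del by rewrite divr_gt0// lt_min !subr_gt0 az zb.
have dela : del * 3 <= x - a by rewrite /del divfK// ge_min lexx.
have delb : del * 3 <= b - x by rewrite /del divfK// ge_min lexx orbT.
pose B t := expR ((x + 2 * del) * u t) + expR ((x - 2 * del) * u t).
pose G t := B t * `|phi t|.
have iG : mu.-integrable D (EFin \o G).
  have h1 : weight (x + 2 * del) by apply: wab; apply/andP; split; lra.
  have h2 : weight (x - 2 * del) by apply: wab; apply/andP; split; lra.
  have := integrableD mD (integrable_norm h1) (integrable_norm h2).
  apply: eq_integrable => // t _ /=.
  rewrite !normrM ![`|expR _|]ger0_norm ?expR_ge0// -EFinD.
  by congr EFin; exact/esym/mulrDl.
have B0 t : 0 <= B t by rewrite addr_ge0// expR_ge0.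
have G0 t : 0 <= G t by rewrite mulr_ge0.
have EB t : expR (x * u t + 2 * (del * `|u t|)) <= B t.
  have [u0|u0] := leP 0 (u t).
    rewrite (ger0_norm u0) /B (_ : _ + _ = (x + 2 * del) * u t); last by ring.
    by rewrite lerDl expR_ge0.
  rewrite (ltr0_norm u0) /B (_ : x * _ + _ = (x - 2 * del) * u t); last by ring.
  by rewrite lerDr expR_ge0.
have wz : weight (Re z) by apply: wab; rewrite az zb.
have iz := Cintegrable_laplace wz.
(* [1 + y <= expR y] with [y = del |u| / 2], squared *)
have udel t : (u t) ^+ 2 <= 4 / del ^+ 2 * expR (del * `|u t|).
  rewrite -(real_normK (num_real (u t))).
  set y := del * `|u t| / 2.
  have h : 1 + y <= expR y by exact: expR_ge1Dx.
  have y0 : 0 <= y by rewrite divr_ge0// mulr_ge0// ltW.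
  have e2 : expR (del * `|u t|) = expR y * expR y.
    by rewrite -expRD; congr expR; rewrite /y; field.
  rewrite mulrAC ler_pdivlMr ?exprn_gt0// e2.
  have -> : `|u t| ^+ 2 * del ^+ 2 = 4 * (y * y) by rewrite /y; field.
  have ye : y <= expR y by lra.
  by rewrite ler_wpM2l// ler_pM.
pose F' := Cintegral mu D (fun t => (u t)%:C * (cexp (z * (u t)%:C) * (phi t)%:C)).
have iF' : Cintegrable mu D (fun t => (u t)%:C * (cexp (z * (u t)%:C) * (phi t)%:C)).
  pose g t := (4 / del ^+ 2 + 1) * G t.
  have ig : mu.-integrable D (EFin \o g).
    have := integrableZl mD (4 / del ^+ 2 + 1) iG.
    by apply: eq_integrable.
  apply: (Cintegrable_le mD _ ig).
    by apply: CmeasurableM => //; exact: Cmeasurable_laplace.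
  move=> t _; have [h1 h2] := laplace_bound z t.
  rewrite cReM cImM /= !mul0r subr0 addr0 !normrM.
  have gt : `|u t| * `|expR (Re z * u t) * phi t| <= g t.
    have k : `|u t| <= (4 / del ^+ 2 + 1) * expR (2 * (del * `|u t|)).
      have : 1 <= expR (del * `|u t|).
        by rewrite -expR0 ler_expR mulr_ge0// ltW.
      have -> : expR (2 * (del * `|u t|)) =
          expR (del * `|u t|) * expR (del * `|u t|).
        by rewrite -expRD; congr expR; ring.
      have := udel t.
      rewrite -(real_normK (num_real (u t))).
      have : 0 <= 4 / del ^+ 2 by rewrite divr_ge0// sqr_ge0.
      move: (4 / _) => c; move: (expR _) => e; move: (`|u t|) => w c0 h e1.
      have : w <= w ^+ 2 + 1 by nra.
      have : c * e <= c * (e * e) by rewrite ler_wpM2l// ler_peMl//; lra.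
      nra.
    rewrite normrM ger0_norm ?expR_ge0// /g /G !mulrA ler_wpM2r//.
    apply: le_trans (ler_wpM2l _ (EB t)); last first.
      by rewrite addr_ge0// divr_ge0// sqr_ge0.
    have -> : expR (x * u t + 2 * (del * `|u t|)) =
        expR (2 * (del * `|u t|)) * expR (x * u t) by rewrite -expRD addrC.
    by rewrite -/x [leRHS]mulrA ler_wpM2r ?expR_ge0.
  by split; apply: le_trans gt; rewrite ler_wpM2l.
pose K := 2 * (16 / del ^+ 2 * \int[mu]_(t in D) G t).
have K0 : 0 <= K.
  by rewrite !mulr_ge0// ?invr_ge0 ?sqr_ge0// Rintegral_ge0// => t _; exact: G0.
(* The integrand of the remainder is the kernel at [z] times [cexp - 1 - id]
   at [h * u], which is quadratic in [h] and dominated by [G]. *)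
have main h : modulus h <= del ->
    modulus (laplace (z + h) - laplace z - h * F') <= K * modulus h ^+ 2.
  move=> hdel.
  have wzh : weight (Re (z + h)).
    have := le_trans (Re_le_modulus h) hdel; rewrite ler_norml => /andP[h1 h2].
    by apply: wab; rewrite cReD -/x; apply/andP; split; lra.
  have izh := Cintegrable_laplace wzh.
  pose k t := cexp (h * (u t)%:C) - 1 - h * (u t)%:C.
  pose r t := cexp (z * (u t)%:C) * (phi t)%:C * k t.
  have rE : r = fun t => cexp ((z + h) * (u t)%:C) * (phi t)%:C +
      (-1 * (cexp (z * (u t)%:C) * (phi t)%:C) +
       (- h) * ((u t)%:C * (cexp (z * (u t)%:C) * (phi t)%:C))).
    by apply/funext => t; rewrite /r /k mulrDl cexpD; ring.
  have i1 := CintegrableZ (-1) mD iz.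
  have i2 := CintegrableZ (- h) mD iF'.
  have i12 := CintegrableD mD i1 i2.
  have ir : Cintegrable mu D r by rewrite rE; exact: CintegrableD.
  have -> : laplace (z + h) - laplace z - h * F' = Cintegral mu D r.
    rewrite rE CintegralD// CintegralD// !CintegralZ// /laplace.
    by rewrite mulN1r mulNr addrA.
  pose c := 16 / del ^+ 2 * modulus h ^+ 2.
  have c0 : 0 <= c by rewrite mulr_ge0 ?sqr_ge0// divr_ge0// sqr_ge0.
  have icG : mu.-integrable D (EFin \o (fun t => c * G t)).
    by have := integrableZl mD c iG; apply: eq_integrable.
  have bnd t : D t -> `|Re (r t)| <= c * G t /\ `|Im (r t)| <= c * G t.
    move=> Dt; have [h1 h2] := laplace_bound z t.
    pose v := modulus h * `|u t|.
    have [k1 k2] := @cexp_taylor _ h (u t) v (lexx _).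
    have v0 : 0 <= v by rewrite mulr_ge0// modulus_ge0.
    have vdel : expR v <= expR (del * `|u t|) by rewrite ler_expR ler_wpM2r.
    have v2 : v ^+ 2 <= modulus h ^+ 2 * (4 / del ^+ 2 * expR (del * `|u t|)).
      by rewrite /v exprMn ler_wpM2l ?sqr_ge0// real_normK// num_real.
    have kb : 2 * v ^+ 2 * expR v <= c / 2 * expR (2 * (del * `|u t|)).
      have -> : expR (2 * (del * `|u t|)) =
          expR (del * `|u t|) * expR (del * `|u t|).
        by rewrite -expRD; congr expR; ring.
      rewrite [leRHS](_ : _ = 2 * (modulus h ^+ 2 *
        (4 / del ^+ 2 * expR (del * `|u t|))) * expR (del * `|u t|)); last first.
        by rewrite /c; field; rewrite gt_eqF.
      rewrite ler_pM// ?expR_ge0//; first by rewrite mulr_ge0// sqr_ge0.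
      by rewrite ler_wpM2l.
    have cG : `|expR (Re z * u t) * phi t| * (c / 2 * expR (2 * (del * `|u t|)))
        *+ 2 <= c * G t.
      rewrite normrM ger0_norm ?expR_ge0// /G.
      rewrite [leLHS](_ : _ = c * (expR (Re z * u t) * expR (2 * (del * `|u t|))
          * `|phi t|)); last by rewrite mulr2n; field.
      by rewrite ler_wpM2l// ler_wpM2r// -expRD.
    move: h1 h2 k1 k2 kb cG; rewrite /r -/(k t).
    move: (cexp _ * _) (k t) (`|_ * phi t|) => A B1 N h1 h2 k1 k2 kb cG.
    have {}k1 := le_trans k1 kb; have {}k2 := le_trans k2 kb.
    rewrite cReM cImM.
    split; apply: le_trans cG; rewrite mulr2n.
      rewrite (le_trans (ler_normB _ _))// !normrM.
      by rewrite lerD// ler_pM.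
    rewrite (le_trans (ler_normD _ _))// !normrM.
    by rewrite lerD// ler_pM.
  apply: (le_trans (modulus_Cintegral_le mD ir icG bnd)).
  by rewrite RintegralZl// /K /c le_eqVlt; apply/orP; left; apply/eqP; ring.
have cvgF' : (fun h : R[i]^o => h^-1 *: (((laplace : R[i]^o -> R[i]^o) \o shift z)
    (h *: (1 : R[i]^o)) - (laplace : R[i]^o -> R[i]^o) z)) @ (0 : R[i]^o)^' --> (F' : R[i]^o).
  apply/cvgrPdist_le => /= e e0.
  have [e' e'0 ->] : exists2 e' : R, 0 < e' & e = e'%:C.
    by move: e0; case: e => er ei; rewrite ltcE/= => /andP[/eqP -> ?]; exists er.
  pose m := Num.min del (e' / (K + 1)).
  have m0 : 0 < m by rewrite lt_min del0/= divr_gt0// ltr_wpDl.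
  near=> h.
  have h0 : h != 0 by near: h; exact: nbhs_dnbhs_neq.
  have hm : `|h| < m%:C by near: h; apply: dnbhs0_lt; rewrite ltcR.
  rewrite normcE ltcR in hm.
  have hd : modulus h <= del by rewrite (le_trans (ltW hm))// ge_min lexx.
  have hK : modulus h * K <= e'.
    apply: (@le_trans _ _ (e' / (K + 1) * (K + 1))).
      rewrite ler_pM ?modulus_ge0// ?lerDl//.
      by rewrite (le_trans (ltW hm))// ge_min lexx orbT.
    by rewrite divfK// gt_eqF// ltr_wpDl.
  rewrite (_ : _ - _ = - (h^-1 * (laplace (z + h) - laplace z - h * F'))); last first.
    rewrite /GRing.scale/= mulr1 (addrC h z) [in RHS]mulrBr mulKf//.
    by rewrite opprB.
  rewrite normrN normrM normfV.
  have hn : 0 < `|h| by rewrite normr_gt0.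
  rewrite mulrC ler_pdivrMr// !normcE -rmorphM lecR.
  apply: (le_trans (main h hd)).
  by rewrite expr2 mulrA ler_wpM2r ?modulus_ge0// mulrC.
by apply/cvg_ex; exists F'.
Unshelve. all: by end_near. Qed.

End Laplace.

(** * Termwise integration *)

Section DominatedSeries.
Context d (T : measurableType d) (R : realType) (mu : {measure set T -> \bar R}).
Variables (D : set T) (mD : measurable D).

Lemma Rintegral_dominated_cvg (f_ : nat -> T -> R) (f g : T -> R) :
  (forall n, measurable_fun D (f_ n)) ->
  (forall t, D t -> f_ n t @[n --> \oo] --> f t) ->
  mu.-integrable D (EFin \o g) ->
  (forall n t, D t -> `|f_ n t| <= g t) ->
  mu.-integrable D (EFin \o f) /\
  \int[mu]_(t in D) f_ n t @[n --> \oo] --> \int[mu]_(t in D) f t.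
Proof.
move=> mf_ cvf ig le_g.
have mf : measurable_fun D f by exact: measurable_fun_cvg mf_ cvf.
have mEf_ n : measurable_fun D (EFin \o f_ n) by exact/measurable_EFinP.
have mEf : measurable_fun D (EFin \o f) by exact/measurable_EFinP.
have cvEf : {ae mu, forall x, D x -> (EFin \o f_ n) x @[n --> \oo] --> (EFin \o f) x}.
  by apply: aeW => t Dt; apply: cvg_EFin; [exact: nearW|exact: cvf].
have Eg : {ae mu, forall x n, D x -> (`|(EFin \o f_ n) x| <= (EFin \o g) x)%E}.
  by apply: aeW => t n Dt; rewrite /= lee_fin le_g.
have [if_ _ cvI] := dominated_convergence mD mEf_ mEf cvEf ig Eg.
split=> //; apply: fine_cvg.
by rewrite fineK//; exact: integrable_fin_num.
Qed.

Lemma Rintegral_sum n (F : nat -> T -> R) :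
  (forall k, mu.-integrable D (EFin \o F k)) ->
  mu.-integrable D (EFin \o (fun t => \sum_(0 <= k < n) F k t)) /\
  \int[mu]_(t in D) (\sum_(0 <= k < n) F k t) =
  \sum_(0 <= k < n) \int[mu]_(t in D) F k t.
Proof.
move=> iF; elim: n => [|n [i1 IH]].
  rewrite big_nil; split.
    apply: (eq_integrable mD _ _ _ (integrable0 mu D)) => // t _.
    by rewrite /= big_nil.
  under eq_Rintegral do rewrite big_nil.
  by rewrite Rintegral_cst// mul0r.
split.
  apply: (eq_integrable mD _ _ _ (integrableD mD i1 (iF n))) => // t _.
  by rewrite /= big_nat_recr.
under eq_Rintegral do rewrite big_nat_recr//=.
by rewrite RintegralD// IH big_nat_recr.
Qed.

(** Termwise integration of a series of nonnegative functions against a signed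
    weight [h]: the full sum dominates the partial sums. *)
Lemma Rintegral_series (F : nat -> T -> R) (h S : T -> R) :
  (forall k, measurable_fun D (F k)) ->
  (forall k t, D t -> 0 <= F k t) ->
  (forall t, D t -> series (F ^~ t) @ \oo --> S t) ->
  measurable_fun D h ->
  mu.-integrable D (EFin \o (fun t => h t * S t)) ->
  (forall k, mu.-integrable D (EFin \o (fun t => h t * F k t))) /\
  series (fun k => \int[mu]_(t in D) (h t * F k t)) @ \oo -->
    \int[mu]_(t in D) (h t * S t).
Proof.
move=> mF F0 cvF mh ihS.
have le_S n t : D t -> 0 <= series (F ^~ t) n <= S t.
  move=> Dt; apply/andP; split; first by apply: sumr_ge0 => k _; exact: F0.
  have nd : nondecreasing_seq (series (F ^~ t)).
    by apply: nondecreasing_series => k _ _; exact: F0.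
  rewrite -(cvg_lim _ (cvF _ Dt))//.
  by apply: nondecreasing_cvgn_le => //; apply/cvg_ex; exists (S t); exact: cvF.
have iF k : mu.-integrable D (EFin \o (fun t => h t * F k t)).
  apply: (le_integrable mD _ _ ihS).
    by apply/measurable_EFinP; exact: measurable_funM.
  move=> t Dt; rewrite /= lee_fin !normrM ler_wpM2l//.
  have /andP[s0 _] := le_S k t Dt; have /andP[_ s1] := le_S k.+1 t Dt.
  rewrite ger0_norm ?F0// ger0_norm; last by rewrite (le_trans _ s1)// seriesSr addr_ge0// F0.
  by rewrite (le_trans _ s1)// seriesSr lerDr.
split=> //.
have := @Rintegral_dominated_cvg (fun n t => h t * series (F ^~ t) n)
  (fun t => h t * S t) (fun t => `|h t * S t|).
case=> //.
- move=> n; apply: measurable_funM => //.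
  by apply: measurable_sum => k; exact: mF.
- by move=> t Dt; apply: cvgMr; exact: cvF.
- exact: integrable_norm ihS.
- move=> n t Dt; rewrite !normrM ler_wpM2l//.
  have /andP[s0 s1] := le_S n t Dt.
  by rewrite !ger0_norm// (le_trans s0).
move=> _; rewrite (_ : (fun n => _) = series (fun k => \int[mu]_(t in D) (h t * F k t)))//.
apply/funext => n.
rewrite seriesEnat/= -(Rintegral_sum n iF).2.
by apply: eq_Rintegral => t _; rewrite seriesEnat/= big_distrr.
Qed.

End DominatedSeries.

(** * Integrals of powers and exponentials *)

Section PowerIntegrals.
Variable R : realType.
Notation mu := (@lebesgue_measure R).
Implicit Types (a b c p x t : R) (z : R[i]) (f F : R -> R).

Lemma FTC2_is_derive f F a b : a < b ->
  (forall t, a <= t <= b -> is_derive t 1 F (f t)) ->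
  (forall t, a <= t <= b -> {for t, continuous f}) ->
  mu.-integrable `[a, b]%classic (EFin \o f) /\
  \int[mu]_(t in `[a, b]) f t = F b - F a.
Proof.
move=> ab dF cf.
have cw : {within `[a, b], continuous f}.
  by apply: continuous_in_subspaceT => t /set_mem /=; rewrite in_itv/=; exact: cf.
have cF t : a <= t <= b -> {for t, continuous F}.
  move=> /dF h; apply/differentiable_continuous/derivable1_diffP.
  exact: ex_derive.
split; first exact: continuous_compact_integrable (@segment_compact _ _ _) cw.
rewrite /Rintegral (continuous_FTC2 (F := F) ab cw)//.
- split.
  + by move=> t; rewrite in_itv/= => /andP[/ltW h1 /ltW h2];
      have /dF h : a <= t <= b by rewrite h1 h2.
  + by apply: cvg_at_right_filter; apply: cF; rewrite lexx ltW.
  + by apply: cvg_at_left_filter; apply: cF; rewrite lexx ltW.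
- move=> t; rewrite in_itv/= => /andP[/ltW h1 /ltW h2].
  have /dF h : a <= t <= b by rewrite h1 h2.
  by rewrite derive1E derive_val.
Qed.

Lemma integral_expR_oo b c : 0 < b ->
  mu.-integrable `[c, +oo[%classic (EFin \o (fun t => expR (- b * t))) /\
  \int[mu]_(t in `[c, +oo[) expR (- b * t) = expR (- b * c) / b.
Proof.
move=> b0; pose F t := - (expR (- b * t) / b).
have dF t : is_derive t 1 F (expR (- b * t)).
  rewrite /F; apply: is_derive_eq.
  by rewrite /GRing.scale/=; field; rewrite gt_eqF.
have cf t : {for t, continuous (fun t => expR (- b * t))}.
  apply: continuous_comp; first exact: mulrl_continuous.
  exact: continuous_expR.
have I : (\int[mu]_(t in `[c, +oo[) (expR (- b * t))%:E = 0%:E - (F c)%:E)%E.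
  apply: ge0_continuous_FTC2y.
  - by move=> t _; exact: expR_ge0.
  - by apply: continuous_subspaceT.
  - rewrite -oppr0; apply: cvgN; rewrite -[0](mul0r b^-1).
    apply: cvgMl; rewrite (_ : (fun x => expR (- b * x)) =
               (fun y : R => expR (- y)) \o (fun y : R => b * y)); last first.
      by apply/funext => t /=; rewrite mulNr.
    apply: (@cvg_comp _ _ _ _ _ _ (pinfty_nbhs R)); last exact: cvgr_expR.
    exact: gt0_cvgMry.
  - by move=> t _; exact: ex_derive.
  - apply: cvg_at_right_filter.
    apply/differentiable_continuous/derivable1_diffP; exact: ex_derive.
  - by move=> t _; rewrite derive1E derive_val.
split; last by rewrite /Rintegral I sub0e /F /= opprK.
apply/integrableP; split.
  apply/measurable_EFinP; apply: (measurable_funS measurableT) => //.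
  exact: continuous_measurable_fun.
under eq_integral do rewrite /= ger0_norm ?expR_ge0//.
by rewrite I -EFinB ltry.
Qed.

Lemma ln_le_linear c t : 0 < c -> 0 < t -> ln t <= c * t - ln c.
Proof.
move=> c0 t0; rewrite lerBrDr addrC -lnM ?posrE//.
by rewrite ltW// ln_sublinear// mulr_gt0.
Qed.

(** [ln t] grows slower than any multiple of [t], so a power is dominated by
    half of the exponential decay. *)
Lemma integrable_power_expR p b : 0 < b ->
  mu.-integrable `[1, +oo[%classic (EFin \o (fun t => expR (p * ln t) * expR (- b * t))).
Proof.
move=> b0.
pose e := b / 2 / (`|p| + 1).
have p1 : 0 < `|p| + 1 by rewrite ltr_wpDl.
have e0 : 0 < e by rewrite !divr_gt0.
pose K := expR (`|p| * - ln e).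
have [i1 _] := integral_expR_oo 1 (divr_gt0 b0 (ltr0Sn R 1)).
have i2 : mu.-integrable `[1, +oo[%classic
    (fun t => K%:E * (expR (- (b / 2) * t))%:E)%E by exact: integrableZl.
apply: le_integrable i2 => //.
  apply/measurable_EFinP; apply: measurable_funTS.
  apply: measurable_funM; apply: measurableT_comp => //.
  apply: measurable_funM => //; exact: measurable_ln.
move=> t /=; rewrite in_itv/= andbT => t1.
have t0 : 0 < t by exact: lt_le_trans t1.
have lt0 : 0 <= ln t by exact: ln_ge0.
rewrite lee_fin !normrM !ger0_norm ?expR_ge0// -!expRD ler_expR.
have h := ln_le_linear e0 t0; have : p * ln t <= `|p| * (e * t - ln e).
  rewrite (le_trans (ler_norm _))// normrM (ger0_norm lt0).
  by rewrite ler_wpM2l.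
have : `|p| * (e * t) <= b / 2 * t.
  rewrite mulrA ler_wpM2r ?(ltW t0)//.
  by rewrite /e mulrCA ler_piMr ?divr_ge0 ?(ltW b0)// ler_pdivrMr// mul1r lerDl.
by lra.
Qed.

Lemma itv01_bigcup : (`]0, 1]%classic : set R) = \bigcup_n `[n.+1%:R^-1, 1]%classic.
Proof.
apply/seteqP; split => t /=.
  rewrite in_itv/= => /andP[t0 t1].
  have [n _ hn] := @near_infty_natSinv_lt R (PosNum t0).
  by exists n => //=; rewrite in_itv/= t1 andbT ltW//; exact: (hn n (leqnn n)).
move=> [n _] /=; rewrite !in_itv/= => /andP[h ->]; rewrite andbT.
by apply: lt_le_trans h; rewrite invr_gt0.
Qed.

(** Reduces an integral that is improper at [0] to compact segments, where the
    fundamental theorem of calculus applies. *)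
Lemma Rintegral01_cvg f : mu.-integrable `]0, 1]%classic (EFin \o f) ->
  \int[mu]_(t in `[n.+1%:R^-1, 1]) f t @[n --> \oo] --> \int[mu]_(t in `]0, 1]) f t.
Proof.
move=> if_; pose f_ n := f \_ `[n.+1%:R^-1, 1].
have mf : measurable_fun (`]0, 1]%classic : set R) f.
  by apply/measurable_EFinP; exact: measurable_int if_.
have sub n : `[n.+1%:R^-1, 1]%classic `<=` (`]0, 1]%classic : set R).
  by rewrite itv01_bigcup => t tn; exists n.
have := @Rintegral_dominated_cvg _ _ R mu _ (measurable_itv `]0, 1]) f_ f
  (fun t => `|f t|).
case.
- move=> n; apply: measurable_funS (measurableT) _ _ => //.
  apply/(measurable_restrictT f) => //.
  exact: measurable_funS mf.
- move=> t; rewrite itv01_bigcup => -[N _ /= hN].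
  apply: cvg_near_cst; exists N => // n /= Nn.
  rewrite /f_ patchE mem_set//=.
  move: hN; rewrite !in_itv/= => /andP[h ->]; rewrite andbT.
  by apply: le_trans h; rewrite lef_pV2 ?posrE// ler_nat.
- exact: integrable_norm if_.
- by move=> n t _; rewrite /f_ patchE; case: ifP => // _; rewrite normr0.
move=> _; rewrite [X in X @ \oo --> _ -> _](_ : _ =
  (fun n => \int[mu]_(t in `[n.+1%:R^-1, 1]) f t))//.
apply/funext => n; rewrite -Rintegral_mkcondr; congr (Rintegral _ _ _).
exact/setIidPr.
Qed.

Lemma is_derive_cexp_ln z t : 0 < t ->
  is_derive t 1 (fun t => Re (cexp (z * (ln t)%:C)))
    (Re (z * cexp ((z - 1) * (ln t)%:C))) /\
  is_derive t 1 (fun t => Im (cexp (z * (ln t)%:C)))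
    (Im (z * cexp ((z - 1) * (ln t)%:C))).
Proof.
move=> t0; have dln := is_derive1_ln t0.
have e : cexp ((z - 1) * (ln t)%:C) = cexp (z * (ln t)%:C) * (t^-1)%:C.
  rewrite mulrBl mul1r cexpD -[t^-1](lnK (x := t^-1)) ?posrE ?invr_gt0//.
  by rewrite lnV ?posrE// -rmorphN cexp_real.
rewrite e; case: z {e} => x y.
have f1 : (fun t => Re (cexp ((x +i* y) * (ln t)%:C))) =
    fun t => expR (x * ln t) * cos (y * ln t).
  by apply/funext => r; rewrite /cexp cReM cImM /= !mulr0 subr0 add0r.
have f2 : (fun t => Im (cexp ((x +i* y) * (ln t)%:C))) =
    fun t => expR (x * ln t) * sin (y * ln t).
  by apply/funext => r; rewrite /cexp cReM cImM /= !mulr0 subr0 add0r.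
rewrite f1 f2; rewrite /cexp !cReM !cImM /= !mulr0 !subr0 !add0r.
by split; apply: is_derive_eq; rewrite /GRing.scale/=; ring.
Qed.

Lemma continuous_cexp_ln z t : 0 < t ->
  {for t, continuous (fun t => Re (cexp (z * (ln t)%:C)))} /\
  {for t, continuous (fun t => Im (cexp (z * (ln t)%:C)))}.
Proof.
move=> t0; have [d1 d2] := is_derive_cexp_ln z t0.
by split; apply/differentiable_continuous/derivable1_diffP; exact: ex_derive.
Qed.

End PowerIntegrals.

Section PowerIntegrals01.
Variable R : realType.
Notation mu := (@lebesgue_measure R).
Implicit Types (a b c p x t : R) (z : R[i]) (f F : R -> R).

Lemma natSinv_itv n : 0 < (n.+1%:R^-1 : R) <= 1.
Proof. by rewrite invr_gt0 ltr0n/= invf_le1// ler1n. Qed.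

(** The antiderivative of [z * t ^ (z - 1)] is [t ^ z], so multiplying by [z]
    avoids any division. *)
Lemma Cintegral_power_segment z b : 0 < b -> b < 1 ->
  z * Cintegral mu `[b, 1]%classic (fun t => cexp ((z - 1) * (ln t)%:C)) =
  1 - cexp (z * (ln b)%:C).
Proof.
move=> b0 b1.
have pos t : b <= t <= 1 -> 0 < t by case/andP => /(lt_le_trans b0).
have d1 t : b <= t <= 1 -> is_derive t 1 (fun t => Re (cexp (z * (ln t)%:C)))
    (Re (z * cexp ((z - 1) * (ln t)%:C))).
  by move=> /pos /(is_derive_cexp_ln z)[].
have d2 t : b <= t <= 1 -> is_derive t 1 (fun t => Im (cexp (z * (ln t)%:C)))
    (Im (z * cexp ((z - 1) * (ln t)%:C))).
  by move=> /pos /(is_derive_cexp_ln z)[].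
have c12 t : b <= t <= 1 ->
    {for t, continuous (fun t => Re (z * cexp ((z - 1) * (ln t)%:C)))} /\
    {for t, continuous (fun t => Im (z * cexp ((z - 1) * (ln t)%:C)))}.
  move=> /pos /(continuous_cexp_ln (z - 1))[c1 c2].
  split; rewrite /prop_for /continuous_at ?cReM ?cImM;
    under eq_fun do rewrite ?cReM ?cImM.
    by apply: cvgB; apply: cvgMr.
  by apply: cvgD; apply: cvgMr.
have [i1 I1] := FTC2_is_derive b1 d1 (fun t bt => (c12 t bt).1).
have [i2 I2] := FTC2_is_derive b1 d2 (fun t bt => (c12 t bt).2).
have ig : Cintegrable mu `[b, 1]%classic (fun t => cexp ((z - 1) * (ln t)%:C)).
  have ct t : b <= t <= 1 ->
    {for t, continuous (fun t => Re (cexp ((z - 1) * (ln t)%:C)))} /\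
    {for t, continuous (fun t => Im (cexp ((z - 1) * (ln t)%:C)))}.
    by move=> /pos /(continuous_cexp_ln (z - 1)).
  split; apply: continuous_compact_integrable (@segment_compact _ _ _) _;
    apply: continuous_in_subspaceT => t /set_mem /=; rewrite in_itv/=;
    by move=> /ct[].
rewrite -CintegralZ//.
by apply: complex_eqP; rewrite ?cReD ?cImD ?cReN ?cImN /= ?I1 ?I2 ln1 mulr0
  cexp0 /=.
Qed.

(** The integrals over the segments [1/n, 1] increase and are bounded by
    [x^-1]. *)
Lemma integrable_power01 x : 0 < x ->
  mu.-integrable `]0, 1]%classic (EFin \o (fun t => expR ((x - 1) * ln t))).
Proof.
move=> x0.
have mf : measurable_fun setT (fun t : R => expR ((x - 1) * ln t)).
  by apply: measurableT_comp => //; apply: measurable_funM => //; exact: measurable_ln.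
apply/integrableP; split; first exact/measurable_EFinP/measurable_funTS.
under eq_integral do rewrite /= ger0_norm ?expR_ge0//.
pose I n := (\int[mu]_(t in `[n.+1%:R^-1%R, 1%R]) (expR ((x - 1) * ln t))%:E)%E.
have cvI : I n @[n --> \oo] -->
    (\int[mu]_(t in `]0%R, 1%R]) (expR ((x - 1) * ln t))%:E)%E.
  rewrite itv01_bigcup; apply: ge0_nondecreasing_set_cvg_integral => //.
  - apply/nondecreasing_seqP => n; apply/subsetPset => t /=.
    rewrite !in_itv/= => /andP[h ->]; rewrite andbT.
    by apply: le_trans h; rewrite lef_pV2 ?posrE// ler_nat.
  - by move=> n; exact/measurable_EFinP/measurable_funTS.
have leI n : (I n.+1 <= (x^-1)%:E)%E.
  have /andP[b0 _] := natSinv_itv n.+1.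
  have b1 : n.+2%:R^-1 < 1 :> R by rewrite invf_lt1// ltr1n.
  have pos t : n.+2%:R^-1 <= t <= 1 -> 0 < t by case/andP => /(lt_le_trans b0).
  have := @FTC2_is_derive R (fun t => expR ((x - 1) * ln t))
    (fun t => expR (x * ln t) / x) _ _ b1.
  case.
  - move=> t /pos t0; have dln := is_derive1_ln t0; apply: is_derive_eq.
    rewrite /GRing.scale/= mulrBl mul1r expRD expRN lnK ?posrE//.
    by field; rewrite !gt_eqF.
  - move=> t /pos t0; have dln := is_derive1_ln t0.
    by apply/differentiable_continuous/derivable1_diffP; exact: ex_derive.
  move=> i1; rewrite /Rintegral => I1.
  rewrite /I -[leLHS]fineK ?I1; last exact: integrable_fin_num i1.
  by rewrite lee_fin ln1 mulr0 expR0 mul1r lerBlDr lerDl divr_ge0 ?expR_ge0// ltW.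
apply: (@le_lt_trans _ _ (x^-1)%:E); last exact: ltry.
rewrite -(cvg_lim _ cvI)//.
apply: lime_le; first by apply/cvg_ex; eexists; exact: cvI.
by exists 1%N => // -[]//= n _; exact: leI.
Qed.

Lemma expR_ln_cvg0 x : 0 < x -> expR (x * ln n.+1%:R^-1) @[n --> \oo] --> (0 : R).
Proof.
move=> x0.
have h : ln t @[t --> (0:R)^'+] --> -oo by exact: lnNy.
have e : (fun n => expR (x * ln n.+1%:R^-1)) = (fun y : R => expR (- y)) \o
    (fun n => x * ln (n.+1%:R : R)).
  by apply/funext => n /=; rewrite lnV ?posrE// mulrN.
rewrite e; apply: (@cvg_comp _ _ _ _ _ _ (pinfty_nbhs R)); last exact: cvgr_expR.
apply/cvgryPge => A.
near=> n.
rewrite mulrC -ler_pdivrMr// -ler_expR lnK ?posrE//.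
apply: (@le_trans _ _ n%:R); last by rewrite ler_nat.
near: n; exact: nbhs_infty_ger.
Unshelve. all: by end_near. Qed.

Lemma Cintegrable_power01 z : 0 < Re z ->
  Cintegrable mu `]0, 1]%classic (fun t => cexp ((z - 1) * (ln t)%:C)).
Proof.
move=> z0.
have mln : measurable_fun (`]0, 1]%classic : set R) (@ln R).
  by apply: measurable_funTS; exact: measurable_ln.
apply: Cintegrable_le (integrable_power01 z0) _ => //.
  exact: Cmeasurable_cexpM.
move=> t _; have e : Re ((z - 1) * (ln t)%:C) = (Re z - 1) * ln t.
  by rewrite !cReM !cReD !cReN /= mulr0 subr0.
by rewrite -e; split; [exact: Re_cexp_le|exact: Im_cexp_le].
Qed.

(** Each power of [t] contributes a simple pole: the boundary term of
    [Cintegral_power_segment] at [1/n] vanishes in the limit. *)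
Lemma Cintegral_power01 z : 0 < Re z ->
  Cintegral mu `]0, 1]%classic (fun t => cexp ((z - 1) * (ln t)%:C)) = z^-1.
Proof.
move=> z0; have [i1 i2] := Cintegrable_power01 z0.
have zn0 : z != 0 by apply: contraTneq z0 => ->; rewrite ltxx.
have c1 := Rintegral01_cvg i1; have c2 := Rintegral01_cvg i2.
set I := Cintegral _ _ _.
pose J n := Cintegral mu `[n.+1%:R^-1, 1]%classic (fun t => cexp ((z - 1) * (ln t)%:C)).
have zJ n : z * J n.+1 = 1 - cexp (z * (ln n.+2%:R^-1)%:C).
  have /andP[b0 _] := natSinv_itv n.+1.
  by rewrite /J Cintegral_power_segment// invf_lt1// ltr1n.
have e0 n : Re (z * (ln n.+2%:R^-1)%:C) = Re z * ln n.+2%:R^-1.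
  by rewrite cReM /= mulr0 subr0.
have cE : expR (Re z * ln n.+2%:R^-1) @[n --> \oo] --> (0 : R).
  by have := expR_ln_cvg0 z0; rewrite -cvg_shiftS.
have cJ1 : Re (J n.+1) @[n --> \oo] --> Re I.
  by move: c1; rewrite -cvg_shiftS.
have cJ2 : Im (J n.+1) @[n --> \oo] --> Im I.
  by move: c2; rewrite -cvg_shiftS.
have sq (u : nat -> R) : (forall n, `|u n| <= expR (Re z * ln n.+2%:R^-1)) ->
    u n @[n --> \oo] --> (0 : R).
  move=> ub; apply/norm_cvg0P; apply: squeeze_cvgr cE => /=; last exact: cvg_cst.
  by apply: nearW => n; rewrite normr_ge0 ub.
suff zI : z * I = 1 by rewrite -[LHS](mulKf zn0) zI mulr1.
apply: complex_eqP.
- have h : Re (z * J n.+1) @[n --> \oo] --> Re (z * I).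
    rewrite cReM; under eq_fun do rewrite cReM.
    by apply: cvgB; apply: cvgMr.
  apply: (cvg_unique _ h) => //=; under eq_fun do rewrite zJ cReD cReN.
  have /sq s0 : forall n, `|Re (cexp (z * (ln n.+2%:R^-1)%:C))| <=
      expR (Re z * ln n.+2%:R^-1) by move=> n; rewrite -e0 Re_cexp_le.
  have s1 : (fun=> Re 1) @ \oo --> (Re (1 : R[i]) : R) by exact: cvg_cst.
  by have := cvgB s1 s0; rewrite subr0; exact.
- have h : Im (z * J n.+1) @[n --> \oo] --> Im (z * I).
    rewrite cImM; under eq_fun do rewrite cImM.
    by apply: cvgD; apply: cvgMr.
  apply: (cvg_unique _ h) => //=; under eq_fun do rewrite zJ cImD cImN.
  have /sq s0 : forall n, `|Im (cexp (z * (ln n.+2%:R^-1)%:C))| <=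
      expR (Re z * ln n.+2%:R^-1) by move=> n; rewrite -e0 Im_cexp_le.
  have s1 : (fun=> Im 1) @ \oo --> (Im (1 : R[i]) : R) by exact: cvg_cst.
  by have := cvgB s1 s0; rewrite subr0; exact.
Qed.

End PowerIntegrals01.

(** * Dilations of the half-line *)

Section HalfLine.
Variable R : realType.
Notation mu := (@lebesgue_measure R).
Implicit Types (a b c p x t : R) (z s : R[i]) (f F : R -> R).

(** Named so that it can carry its measurability, which a pushforward of a
    measure requires. *)
Definition dilation c (t : measurableTypeR R) : measurableTypeR R := c * t.

Lemma measurable_dilation c : measurable_fun setT (dilation c).
Proof. by apply: measurable_funM => //; exact: measurable_cst. Qed.

HB.instance Definition _ c :=
  isMeasurableFun.Build _ _ _ _ (dilation c) (measurable_dilation c).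

(** Both sides agree on intervals, and these determine the measure. *)
Lemma lebesgue_measure_dilation c (c0 : 0 < c) (A : set R) : measurable A ->
  pushforward mu (dilation c) A = (c^-1%:E * mu A)%E.
Proof.
move=> mA; have k0 : 0 <= c by exact: ltW.
have kV : 0 <= c^-1 by rewrite invr_ge0.
have <- : pushforward (mscale (NngNum k0) mu) (dilation c) A = mu A; last first.
  by rewrite /pushforward /mscale/= muleA -EFinM mulVf ?gt_eqF// mul1e.
apply/esym/lebesgue_measure_unique => //= _ [[a b]] _ <-.
rewrite /mscale /pushforward /=.
have -> : dilation c @^-1` `]a, b]%classic = `](a / c), (b / c)]%classic.
  apply/seteqP; split => t /=; rewrite !in_itv/= /dilation;
  by rewrite ltr_pdivrMr// ler_pdivlMr// (mulrC t).
rewrite !lebesgue_measure_itv/= !lte_fin ltr_pM2r ?invr_gt0//.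
case: ifPn => _; last by rewrite mule0.
by rewrite -!EFinB -EFinM -mulrBl mulrC divfK ?gt_eqF.
Qed.

Lemma ge0_integral_dilation c (f : R -> \bar R) : 0 < c ->
  measurable_fun setT f -> (forall t, 0 <= f t)%E ->
  (\int[mu]_(t in `]0%R, +oo[) f (c * t)%R =
   c^-1%:E * \int[mu]_(t in `]0%R, +oo[) f t)%E.
Proof.
move=> c0 mf f0.
have kV : 0 <= c^-1 by rewrite invr_ge0 ltW.
have pre : dilation c @^-1` `]0, +oo[%classic = (`]0, +oo[%classic : set R).
  by apply/seteqP; split => t /=; rewrite !in_itv/= !andbT /dilation pmulr_rgt0.
transitivity (\int[pushforward mu (dilation c)]_(t in `]0%R, +oo[) f t)%E.
  rewrite ge0_integral_pushforward ?pre//.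
  exact: measurable_funTS.
rewrite (eq_measure_integral (mscale (NngNum kV) mu)).
  by rewrite ge0_integral_mscale//; exact: measurable_funTS.
by move=> A mA _; exact: lebesgue_measure_dilation.
Qed.

Lemma integrable_dilation c f : 0 < c -> measurable_fun setT f ->
  mu.-integrable `]0, +oo[%classic (EFin \o f) ->
  mu.-integrable `]0, +oo[%classic (EFin \o (fun t => f (c * t))) /\
  \int[mu]_(t in `]0, +oo[) f (c * t) = c^-1 * \int[mu]_(t in `]0, +oo[) f t.
Proof.
move=> c0 mf if_.
have mEf : measurable_fun setT (EFin \o f) by exact/measurable_EFinP.
split.
  apply/integrableP; split.
    apply/measurable_EFinP/measurable_funTS.
    apply: (@measurableT_comp _ _ _ _ _ _ f) => //; exact: measurable_dilation.
  rewrite (ge0_integral_dilation (f := fun t => `|(f t)%:E|%E) c0)//; last first.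
    exact: measurableT_comp.
  have /integrableP[_ h] := if_.
  by rewrite lte_mul_pinfty// ?lee_fin ?invr_ge0 ?(ltW c0).
have i1 := integrable_pos_fin_num _ if_.
have i2 := integrable_neg_fin_num _ if_.
have ep : ((fun t => (f (c * t))%:E)^\+ = fun t => (EFin \o f)^\+ (c * t)%R)%E.
  exact: (funepos_comp (EFin \o f) (fun t => c * t)).
have en : ((fun t => (f (c * t))%:E)^\- = fun t => (EFin \o f)^\- (c * t)%R)%E.
  exact: (funeneg_comp (EFin \o f) (fun t => c * t)).
rewrite /Rintegral integralE ep en.
rewrite (ge0_integral_dilation (f := (EFin \o f)^\+%E) c0)//; last exact: measurable_funepos.
rewrite (ge0_integral_dilation (f := (EFin \o f)^\-%E) c0)//; last exact: measurable_funeneg.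
rewrite [in RHS]integralE.
have {}i1 := i1 (measurable_itv _); have {}i2 := i2 (measurable_itv _).
by rewrite -(fineK i1) -(fineK i2) -!EFinM -!EFinB /= mulrBr.
Qed.

Lemma integrable_halfline f : measurable_fun (`]0, +oo[%classic : set R) f ->
  mu.-integrable `]0, 1]%classic (EFin \o f) ->
  mu.-integrable `[1, +oo[%classic (EFin \o f) ->
  mu.-integrable `]0, +oo[%classic (EFin \o f) /\
  \int[mu]_(t in `]0, +oo[) f t =
  \int[mu]_(t in `]0, 1]) f t + \int[mu]_(t in `[1, +oo[) f t.
Proof.
move=> mf i1 i2.
have U : (`]0, 1]%classic `|` `]1, +oo[%classic : set R) = `]0, +oo[%classic.
  apply/seteqP; split => t /=; rewrite !in_itv/= !andbT.
    by case=> [/andP[]//|]; exact: lt_trans.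
  by move=> t0; have [|] := leP t 1; [left; rewrite t0|right].
have i2' : mu.-integrable `]1, +oo[%classic (EFin \o f).
  apply: integrableS i2 => //; apply: subset_itvr; by rewrite bnd_simp.
have i : mu.-integrable `]0, +oo[%classic (EFin \o f).
  rewrite -U; apply/integrableP; split; first by rewrite U; exact/measurable_EFinP.
  rewrite ge0_integral_setU//=.
  - by apply: lte_add_pinfty; [have /integrableP[] := i1|have /integrableP[] := i2'].
  - by rewrite U; apply/measurable_EFinP; exact: measurableT_comp.
  - apply/disj_setPS => t /= []; rewrite !in_itv/= andbT => /andP[_ h1] h2.
    by have := lt_le_trans h2 h1; rewrite ltxx.
split=> //.
rewrite -U Rintegral_setU ?U//.
  by rewrite (Rintegral_itv_obnd_cbnd i2').
apply/disj_setPS => t /= []; rewrite !in_itv/= andbT => /andP[_ h1] h2.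
by have := lt_le_trans h2 h1; rewrite ltxx.
Qed.

End HalfLine.

(** * Mellin transforms and the Gamma function *)

Section Mellin.
Variable R : realType.
Notation mu := (@lebesgue_measure R).
Implicit Types (a b c p x t : R) (z s : R[i]) (f F phi : R -> R)
  (D : set (measurableTypeR R)).

(** Euler's integral is the transform of [t |-> expR (- t)] on the half-line. *)
Definition mellin D phi s : R[i] :=
  Cintegral mu D (fun t => cpow t (s - 1) * (phi t)%:C).

(** The absolute integrability of the transform depends on the real part of the
    argument only. *)
Definition mellin_weight D phi x :=
  mu.-integrable D (EFin \o (fun t => expR ((x - 1) * ln t) * phi t)).

Lemma measurable_ln_on D : measurable_fun D (@ln R).
Proof. by apply: measurable_funTS; exact: measurable_ln. Qed.

Lemma Cintegrable_mellin D phi s : measurable D -> measurable_fun D phi ->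
  mellin_weight D phi (Re s) ->
  Cintegrable mu D (fun t => cpow t (s - 1) * (phi t)%:C).
Proof.
move=> mD mphi h; apply: Cintegrable_laplace => //; first exact: measurable_ln_on.
by move: h; rewrite /mellin_weight cReD cReN.
Qed.

Lemma derivable_mellin D phi a b s : measurable D -> measurable_fun D phi ->
  (forall x, a < x < b -> mellin_weight D phi x) -> a < Re s < b ->
  derivable (mellin D phi : R[i]^o -> R[i]^o) s 1.
Proof.
move=> mD mphi w /andP[a_s sb].
have w' x : a - 1 < x < b - 1 ->
    mu.-integrable D (EFin \o (fun t => expR (x * ln t) * phi t)).
  move=> /andP[ax xb]; have := w (x + 1); rewrite /mellin_weight addrK; apply.
  by apply/andP; split; lra.
have := derivable_laplace mD (measurable_ln_on (D := D)) mphi w' (z := s - 1).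
have -> : a - 1 < Re (s - 1) < b - 1.
  by rewrite cReD cReN /= !ltrD2r a_s sb.
move=> /(_ isT); rewrite /derivable.
by under eq_fun do rewrite /= addrA.
Qed.

Lemma Cintegral_halfline (f : R -> R[i]) :
  Cmeasurable (`]0, +oo[%classic : set (measurableTypeR R)) f ->
  Cintegrable mu `]0, 1]%classic f -> Cintegrable mu `[1, +oo[%classic f ->
  Cintegrable mu `]0, +oo[%classic f /\
  Cintegral mu `]0, +oo[%classic f =
  Cintegral mu `]0, 1]%classic f + Cintegral mu `[1, +oo[%classic f.
Proof.
move=> [m1 m2] [i1 i2] [j1 j2].
have [k1 e1] := integrable_halfline m1 i1 j1.
have [k2 e2] := integrable_halfline m2 i2 j2.
by split=> //; apply: complex_eqP; rewrite ?cReD ?cImD /=.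
Qed.

Lemma mellin_weight_expR x b : 0 < x -> 0 < b ->
  mellin_weight `]0, +oo[%classic (fun t => expR (- b * t)) x.
Proof.
move=> x0 b0.
have mf : measurable_fun setT (fun t : R => expR ((x - 1) * ln t) * expR (- b * t)).
  apply: measurable_funM; apply: measurableT_comp => //;
    apply: measurable_funM => //; exact: measurable_ln.
have i1 : mu.-integrable `]0, 1]%classic
    (EFin \o (fun t => expR ((x - 1) * ln t) * expR (- b * t))).
  apply: le_integrable (integrable_power01 x0) => //.
    exact/measurable_EFinP/measurable_funTS.
  move=> t /=; rewrite in_itv/= => /andP[t0 _]; rewrite lee_fin.
  rewrite !ger0_norm ?mulr_ge0 ?expR_ge0// ler_piMr ?expR_ge0//.
  by rewrite -expR0 ler_expR mulNr oppr_le0 mulr_ge0// ltW.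
by have [] := integrable_halfline (measurable_funTS mf) i1 (integrable_power_expR (x - 1) b0).
Qed.

Lemma cpowM a b z : 0 < a -> 0 < b -> cpow (a * b) z = cpow a z * cpow b z.
Proof.
by move=> a0 b0; rewrite /cpow lnM ?posrE// rmorphD mulrDr cexpD.
Qed.

Lemma cpowB1 c z : 0 < c -> cpow c (z - 1) = cpow c z * (c^-1)%:C.
Proof.
move=> c0; rewrite /cpow mulrBl mul1r cexpD; congr (_ * _).
by rewrite -rmorphN cexp_real -lnV ?posrE// lnK// posrE invr_gt0.
Qed.

(** The substitution [t |-> c t] in Euler's integral. *)
Lemma cGamma_dilation c s : 0 < c -> 0 < Re s ->
  cpow c (- s) * cGamma s = mellin `]0, +oo[%classic (fun t => expR (- c * t)) s.
Proof.
move=> c0 s0.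
pose f t := cpow t (s - 1) * (expR (- t))%:C.
have mf : Cmeasurable setT f.
  by apply: Cmeasurable_laplace => //; exact: measurableT_comp.
have i1 : Cintegrable mu `]0, +oo[%classic f.
  apply: Cintegrable_mellin => //; first exact/measurable_funTS/measurableT_comp.
  have -> : (fun t => expR (- t)) = (fun t : R => expR (- 1 * t)).
    by apply/funext => t; rewrite mulN1r.
  exact: mellin_weight_expR.
have [j1 e1] := integrable_dilation c0 mf.1 i1.1.
have [j2 e2] := integrable_dilation c0 mf.2 i1.2.
have ig : Cintegrable mu `]0, +oo[%classic
    (fun t => cpow t (s - 1) * (expR (- c * t))%:C).
  apply: Cintegrable_mellin => //; last exact: mellin_weight_expR.
  by apply/measurable_funTS/measurableT_comp => //; exact: measurable_funM.
have E : Cintegral mu `]0, +oo[%classic (fun t => f (c * t)) = (c^-1)%:C * cGamma s.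
  by apply: complex_eqP; rewrite /= ?e1 ?e2 ?cReM ?cImM /= !mul0r ?subr0 ?addr0.
have E' : Cintegral mu `]0, +oo[%classic (fun t => f (c * t)) =
    cpow c (s - 1) * mellin `]0, +oo[%classic (fun t => expR (- c * t)) s.
  rewrite -CintegralZ//; apply: eq_Cintegral => t /set_mem /=.
  rewrite in_itv/= andbT => t0.
  by rewrite /f cpowM// mulrA mulNr.
have cc : cpow c (- s) * cpow c s = 1 by rewrite /cpow mulNr cexpN.
have cV : c%:C * (c^-1)%:C = 1 by rewrite -rmorphM mulfV ?gt_eqF.
rewrite (cpowB1 s c0) in E'.
move: (cpow c (- s)) (cpow c s) (cGamma s) (mellin _ _ _) (Cintegral _ _ _)
  (c%:C) ((c^-1)%:C) cc cV E E' => p q G M I x y pq xy -> e.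
transitivity (x * p * (y * G)); first by rewrite -[LHS]mul1r -xy; ring.
by rewrite e; transitivity ((p * q) * (x * y) * M); [ring|rewrite pq xy !mul1r].
Qed.

(** On [1, 2] the integrand is at least a positive constant, since there
    [0 <= ln t <= 1]. *)
Lemma Rintegral_power_expR_gt0 D p : measurable D -> `[1, 2] `<=` D ->
  mu.-integrable D (EFin \o (fun t => expR (p * ln t) * expR (- t))) ->
  0 < \int[mu]_(t in D) (expR (p * ln t) * expR (- t)).
Proof.
move=> mD sD i.
pose f t := expR (p * ln t) * expR (- t).
pose c := expR (- `|p| - 2).
have cf t : `[1, 2]%classic t -> c <= f t.
  rewrite /= in_itv/= => /andP[t1 t2]; rewrite /f -expRD ler_expR lerD//; last first.
    by rewrite lerN2.
  have l0 : 0 <= ln t by exact: ln_ge0.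
  have l1 : ln t <= 1.
    have := @le_ln1Dx R (t - 1); rewrite (addrC 1) subrK => h.
    by apply: le_trans (h _) _; lra.
  have : `|p * ln t| <= `|p| by rewrite normrM (ger0_norm l0) ler_piMr.
  by rewrite ler_norml => /andP[].
have mf : measurable_fun setT f.
  apply: measurable_funM; apply: measurableT_comp => //.
  by apply: measurable_funM => //; exact: measurable_ln.
have m12 : mu (`[1, 2]%classic : set R) = 1%:E.
  by rewrite lebesgue_measure_itv/= lte_fin ltr1n -EFinB; congr EFin; lra.
rewrite -lte_fin fineK; last exact: integrable_fin_num i.
apply: (@lt_le_trans _ _ (c%:E)); first by rewrite lte_fin expR_gt0.
apply: (@le_trans _ _ (\int[mu]_(t in `[1%R, 2%R]) (f t)%:E)%E); last first.
  apply: ge0_subset_integral => //; first exact/measurable_EFinP/measurable_funTS.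
  by move=> t _; rewrite lee_fin mulr_ge0// expR_ge0.
rewrite [leLHS](_ : _ = \int[mu]_(t in `[1%R, 2%R]) c%:E)%E; last first.
  rewrite integral_cst// [X in (_ * X)%E](_ : _ = 1%:E) ?mule1//; exact: m12.
apply: ge0_le_integral => //.
- by move=> t _; rewrite lee_fin expR_ge0.
- exact/measurable_EFinP/measurable_funTS.
Qed.

End Mellin.

(** * Heat sums *)

Section HeatSeries.
Variable R : realType.
Notation mu := (@lebesgue_measure R).
Implicit Types (x t : R) (s : R[i]).
Variables (w lam : nat -> R) (a : R).
Hypotheses (a0 : 0 < a) (w0 : forall k, 0 <= w k) (lama : forall k, a <= lam k).

Definition heat_term t k : R := w k * expR (- t * lam k).

Hypothesis cvg_heat : forall t, 0 < t -> cvgn (series (heat_term t)).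

Definition heat_sum t : R := limn (series (heat_term t)).

Local Notation Z := heat_sum.

Lemma heat_sum_cvg t : 0 < t -> series (heat_term t) @ \oo --> Z t.
Proof. exact: cvg_heat. Qed.

Lemma heat_term_ge0 t k : 0 <= heat_term t k.
Proof. by rewrite mulr_ge0// expR_ge0. Qed.

Lemma heat_sum_ge0 t : 0 < t -> 0 <= Z t.
Proof.
move=> t0; apply: limr_ge; first exact: cvg_heat.
by apply: nearW => n; apply: sumr_ge0 => k _; exact: heat_term_ge0.
Qed.

Lemma lam_gt0 k : 0 < lam k. Proof. exact: lt_le_trans (lama k). Qed.

Lemma heat_sum_nonincr t x : 0 < t -> t <= x -> Z x <= Z t.
Proof.
move=> t0 tx; apply: ler_lim; [exact/cvg_heat/(lt_le_trans t0)|exact: cvg_heat|].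
apply: nearW => n; apply: ler_sum => k _.
by rewrite ler_wpM2l// ler_expR !mulNr lerN2 ler_wpM2r// ltW// lam_gt0.
Qed.

(** All the exponents are at least [a], so [expR (a * t) * Z t] is
    nonincreasing. *)
Lemma heat_sum_decay x t : 0 < x -> x <= t ->
  Z t <= Z x * expR (a * x) * expR (- a * t).
Proof.
move=> x0 xt; rewrite -mulrA -expRD -[leRHS]/(_ * _).
have c1 := heat_sum_cvg x0.
apply: (@ler_cvg_to _ \oo _ _ (series (heat_term t))
  (fun n => series (heat_term x) n * expR (a * x - a * t))).
- by apply: heat_sum_cvg; exact: lt_le_trans xt.
- by rewrite -mulNr; apply: cvgMl.
- apply: nearW => n; rewrite /series/= big_distrl/=; apply: ler_sum => k _.
  rewrite /heat_term -mulrA -expRD ler_wpM2l// ler_expR.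
  have := lama k; move: (lam k) => l al; nra.
Qed.

Lemma measurable_heat_term k : measurable_fun setT (fun t : R => heat_term t k).
Proof.
apply: measurable_funM => //; apply: measurableT_comp => //.
by apply: measurable_funM => //; exact: measurableT_comp.
Qed.

Lemma measurable_heat_sum :
  measurable_fun (`]0, +oo[%classic : set (measurableTypeR R)) Z.
Proof.
apply: (@measurable_fun_cvg _ _ _ _ (fun n t => series (heat_term t) n)).
- move=> n; apply: measurable_funTS; apply: measurable_sum => k.
  exact: measurable_heat_term.
- by move=> t /=; rewrite in_itv/= andbT => t0; exact: heat_sum_cvg.
Qed.

Lemma measurable_heat_sum_oo :
  measurable_fun (`[1, +oo[%classic : set (measurableTypeR R)) Z.
Proof.
apply: measurable_funS measurable_heat_sum => //.
by apply: subset_itvr; rewrite bnd_simp.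
Qed.

Lemma measurable_heat_sum01 :
  measurable_fun (`]0, 1]%classic : set (measurableTypeR R)) Z.
Proof.
apply: measurable_funS measurable_heat_sum => //.
by apply: subset_itvl; rewrite bnd_simp.
Qed.

(** No restriction on [x]: the exponential decay absorbs every power, and this is
    why the part of the transform over [t >= 1] is entire. *)
Lemma mellin_weight_heat_oo x : mellin_weight `[1, +oo[%classic Z x.
Proof.
have i := integrable_power_expR (x - 1) a0.
have i' : mu.-integrable `[1, +oo[%classic (fun t => (Z 1 * expR (a * 1))%:E *
    (expR ((x - 1) * ln t) * expR (- a * t))%:E)%E by exact: integrableZl.
apply: le_integrable i' => //.
  apply/measurable_EFinP; apply: measurable_funM; last exact: measurable_heat_sum_oo.
  apply: measurableT_comp => //; apply: measurable_funM => //.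
  exact: measurable_ln_on.
move=> t /=; rewrite in_itv/= andbT => t1.
have t0 : 0 < t by exact: lt_le_trans t1.
rewrite lee_fin [leRHS]ger0_norm; last first.
  by rewrite !mulr_ge0 ?expR_ge0// heat_sum_ge0.
rewrite ger0_norm ?mulr_ge0 ?expR_ge0 ?heat_sum_ge0// mulrCA.
by rewrite ler_wpM2l ?expR_ge0// heat_sum_decay.
Qed.

Section ZetaGamma.
Variable s : R[i].
Hypotheses (s_gt0 : 0 < Re s) (wZ : mellin_weight `]0, +oo[%classic Z (Re s)).

Lemma Cintegrable_mellin_heat :
  Cintegrable mu `]0, +oo[%classic (fun t => cpow t (s - 1) * (Z t)%:C).
Proof. exact: Cintegrable_mellin measurable_heat_sum _. Qed.

(** Termwise, [cGamma_dilation] recognizes the transform of each exponential as a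
    term of the zeta series times Gamma. *)
Lemma series_zeta_Gamma :
  (fun n => \sum_(0 <= k < n) w k * Re (cpow (lam k) (- s) * cGamma s)) @ \oo -->
    Re (mellin `]0, +oo[%classic Z s) /\
  (fun n => \sum_(0 <= k < n) w k * Im (cpow (lam k) (- s) * cGamma s)) @ \oo -->
    Im (mellin `]0, +oo[%classic Z s).
Proof.
have [i1 i2] := Cintegrable_mellin_heat.
have mI : measurable (`]0, +oo[%classic : set (measurableTypeR R)) by [].
have mc := Cmeasurable_cexpM (s - 1) mI (@measurable_ln_on R `]0, +oo[%classic).
have ReZ t : Re (cpow t (s - 1) * (Z t)%:C) = Re (cpow t (s - 1)) * Z t.
  by rewrite cReM /= mulr0 subr0.
have ImZ t : Im (cpow t (s - 1) * (Z t)%:C) = Im (cpow t (s - 1)) * Z t.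
  by rewrite cImM /= mulr0 add0r.
have mH k : measurable_fun (`]0, +oo[%classic : set (measurableTypeR R))
    (fun t => heat_term t k).
  apply: measurable_funTS; exact: measurable_heat_term.
have H0 k t : `]0, +oo[%classic t -> 0 <= heat_term t k.
  by move=> _; exact: heat_term_ge0.
have cH t : `]0, +oo[%classic t -> series (fun k => heat_term t k) @ \oo --> Z t.
  by rewrite /= in_itv/= andbT => t0; exact: heat_sum_cvg.
have ck k : Cintegrable mu `]0, +oo[%classic
    (fun t => cpow t (s - 1) * (expR (- lam k * t))%:C).
  apply: Cintegrable_mellin => //; last exact/mellin_weight_expR/lam_gt0.
  by apply/measurable_funTS/measurableT_comp => //; exact: measurable_funM.
split.
- have j : mu.-integrable `]0, +oo[%classic
      (EFin \o (fun t => Re (cpow t (s - 1)) * Z t)).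
    by apply: eq_integrable i1 => // t _; rewrite /comp ReZ.
  have -> : Re (mellin `]0, +oo[%classic Z s) =
      \int[mu]_(t in `]0, +oo[) (Re (cpow t (s - 1)) * Z t).
    by apply: eq_Rintegral => t _; rewrite ReZ.
  have [_] := @Rintegral_series _ _ R mu _ mI (fun k t => heat_term t k)
    (fun t => Re (cpow t (s - 1))) Z mH H0 cH mc.1 j.
  apply: cvg_trans; apply: near_eq_cvg; apply: nearW => n.
  apply: eq_bigr => k _; rewrite cGamma_dilation ?lam_gt0//.
  have -> : Re (mellin `]0, +oo[%classic (fun t => expR (- lam k * t)) s) =
    \int[mu]_(t in `]0, +oo[) Re (cpow t (s - 1) * (expR (- lam k * t))%:C) by [].
  rewrite -RintegralZl//; last exact: (ck k).1.
  apply: eq_Rintegral => t _; rewrite cReMr /heat_term.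
  by rewrite mulrCA !mulNr (mulrC (lam k)).
- have j : mu.-integrable `]0, +oo[%classic
      (EFin \o (fun t => Im (cpow t (s - 1)) * Z t)).
    by apply: eq_integrable i2 => // t _; rewrite /comp ImZ.
  have -> : Im (mellin `]0, +oo[%classic Z s) =
      \int[mu]_(t in `]0, +oo[) (Im (cpow t (s - 1)) * Z t).
    by apply: eq_Rintegral => t _; rewrite ImZ.
  have [_] := @Rintegral_series _ _ R mu _ mI (fun k t => heat_term t k)
    (fun t => Im (cpow t (s - 1))) Z mH H0 cH mc.2 j.
  apply: cvg_trans; apply: near_eq_cvg; apply: nearW => n.
  apply: eq_bigr => k _; rewrite cGamma_dilation ?lam_gt0//.
  have -> : Im (mellin `]0, +oo[%classic (fun t => expR (- lam k * t)) s) =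
    \int[mu]_(t in `]0, +oo[) Im (cpow t (s - 1) * (expR (- lam k * t))%:C) by [].
  rewrite -RintegralZl//; last exact: (ck k).2.
  apply: eq_Rintegral => t _; rewrite cImMr /heat_term.
  by rewrite mulrCA !mulNr (mulrC (lam k)).
Qed.

End ZetaGamma.

End HeatSeries.

(** * Zeta series *)

Section ZetaSeries.
Variable R : realType.
Notation mu := (@lebesgue_measure R).
Implicit Types (x t : R) (s : R[i]).
Variables (w lam : nat -> R) (a : R).
Hypotheses (a0 : 0 < a) (w0 : forall k, 0 <= w k) (lama : forall k, a <= lam k).
Hypothesis cvg_heat : forall t, 0 < t -> cvgn (series (heat_term w lam t)).

Local Notation Z := (heat_sum w lam).

Lemma Re_cGamma_gt0 x : 0 < x -> 0 < Re (cGamma x%:C).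
Proof.
move=> x0; have h := mellin_weight_expR x0 ltr01.
have E : (fun t => expR ((x - 1) * ln t) * expR (- (1 : R) * t)) =
    (fun t => expR ((x - 1) * ln t) * expR (- t)).
  by apply/funext => t; rewrite mulN1r.
rewrite /mellin_weight E in h.
have -> : Re (cGamma x%:C) =
    \int[mu]_(t in `]0, +oo[) (expR ((x - 1) * ln t) * expR (- t)).
  apply: eq_Rintegral => t _; rewrite cReMr /cpow.
  have -> : x%:C - 1 = (x - 1)%:C by rewrite rmorphB.
  by rewrite -rmorphM cexp_real.
apply: Rintegral_power_expR_gt0 h => //.
by apply: subset_itv => //; rewrite bnd_simp.
Qed.

(** The transform of [Z] is the sum of the series times Gamma, which is positive
    at a real argument and can be divided out. *)
Lemma cvg_zeta_real x : 0 < x -> mellin_weight `]0, +oo[%classic Z x ->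
  cvgn (series (fun k => w k * expR (- x * ln (lam k)))).
Proof.
move=> x0 wx; have G0 := Re_cGamma_gt0 x0.
have [h _] := series_zeta_Gamma a0 w0 lama cvg_heat (s := x%:C) x0 wx.
have e k : w k * Re (cpow (lam k) (- x%:C) * cGamma x%:C) =
    w k * expR (- x * ln (lam k)) * Re (cGamma x%:C).
  have -> : cpow (lam k) (- x%:C) = (expR (- x * ln (lam k)))%:C.
    by rewrite /cpow -(rmorphN (real_complex R)) -rmorphM cexp_real.
  by rewrite (mulrC _ (cGamma _)) cReMr (mulrC (Re _)) mulrA.
have {}h : (fun n => series (fun k => w k * expR (- x * ln (lam k))) n *
    Re (cGamma x%:C)) @ \oo --> Re (mellin `]0, +oo[%classic Z x%:C).
  apply: cvg_trans h; apply: near_eq_cvg; apply: nearW => n /=.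
  by rewrite /series/= big_distrl; apply: eq_bigr => k _ /=; rewrite e.
set G := Re _ in h G0 *; set l := Re (mellin _ _ _) in h.
have c : (fun n => series (fun k => w k * expR (- x * ln (lam k))) n * G * G^-1)
    @ \oo --> l * G^-1 by apply: cvgMl; exact: h.
apply/cvg_ex; exists (l * G^-1).
by apply: cvg_trans c; apply: near_eq_cvg; apply: nearW => n; rewrite mulfK ?gt_eqF.
Qed.

Lemma cvg_zeta_norm s : 0 < Re s -> mellin_weight `]0, +oo[%classic Z (Re s) ->
  cvgn (series (fun k => w k * `|Re (cpow (lam k) (- s))|)) /\
  cvgn (series (fun k => w k * `|Im (cpow (lam k) (- s))|)).
Proof.
move=> s0 ws; have c := cvg_zeta_real s0 ws.
have e k : Re (- s * (ln (lam k))%:C) = - Re s * ln (lam k).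
  by rewrite cReMr cReN.
split; apply: series_le_cvg c => k; rewrite ?mulr_ge0 ?expR_ge0//;
  rewrite ler_wpM2l// -e.
- exact: Re_cexp_le.
- exact: Im_cexp_le.
Qed.

Lemma cvg_zeta s : 0 < Re s -> mellin_weight `]0, +oo[%classic Z (Re s) ->
  cvgn (series (fun k => w k * Re (cpow (lam k) (- s)))) /\
  cvgn (series (fun k => w k * Im (cpow (lam k) (- s)))).
Proof.
move=> s0 ws; have [c1 c2] := cvg_zeta_norm s0 ws.
split; apply: normed_cvg; rewrite /normed_series_of;
  [move: c1|move: c2]; congr (cvgn (series _)); apply/funext => k;
  by rewrite [RHS]normrM (ger0_norm (w0 k)).
Qed.

Lemma cvg_series_mulc (z : nat -> R[i]) (G : R[i]) :
  cvgn (series (fun k => w k * Re (z k))) -> cvgn (series (fun k => w k * Im (z k))) ->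
  let S := limn (series (fun k => w k * Re (z k))) +i*
           limn (series (fun k => w k * Im (z k))) in
  (fun n => \sum_(0 <= k < n) w k * Re (z k * G)) @ \oo --> Re (S * G) /\
  (fun n => \sum_(0 <= k < n) w k * Im (z k * G)) @ \oo --> Im (S * G).
Proof.
move=> c1 c2 S.
have lim_mulr (b : R) (u : nat -> R) : cvgn u -> u n * b @[n --> \oo] --> limn u * b.
  by move=> c; apply: cvgMl; exact: c.
split.
- rewrite cReM /=.
  have h := cvgB (lim_mulr (Re G) _ c1) (lim_mulr (Im G) _ c2).
  apply: cvg_trans (h _); apply: near_eq_cvg; apply: nearW => n /=.
  rewrite !fctE /series/= !big_distrl/= -sumrB; apply: eq_bigr => k _.
  by rewrite cReM mulrBr !mulrA.
- rewrite cImM /=.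
  have h := cvgD (lim_mulr (Im G) _ c1) (lim_mulr (Re G) _ c2).
  apply: cvg_trans (h _); apply: near_eq_cvg; apply: nearW => n /=.
  rewrite !fctE /series/= !big_distrl/= -big_split/=; apply: eq_bigr => k _.
  by rewrite cImM mulrDr !mulrA.
Qed.

Lemma zeta_Gamma_mellin s : 0 < Re s -> mellin_weight `]0, +oo[%classic Z (Re s) ->
  (limn (series (fun k => w k * Re (cpow (lam k) (- s)))) +i*
   limn (series (fun k => w k * Im (cpow (lam k) (- s))))) * cGamma s =
  mellin `]0, +oo[%classic Z s.
Proof.
move=> s0 ws; have [c1 c2] := cvg_zeta s0 ws.
have [h1 h2] := series_zeta_Gamma a0 w0 lama cvg_heat s0 ws.
have [k1 k2] := cvg_series_mulc (cGamma s) c1 c2.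
by apply: complex_eqP; [apply: (cvg_unique _ k1 h1)|apply: (cvg_unique _ k2 h2)].
Qed.

End ZetaSeries.

(** * Continuation of the Mellin transform of a heat sum *)

Section Continuation.
Variable R : realType.
Notation mu := (@lebesgue_measure R).
Implicit Types (x t : R) (z : R[i]).
Variables (w lam : nat -> R) (a : R).
Hypotheses (a0 : 0 < a) (w0 : forall k, 0 <= w k) (lama : forall k, a <= lam k).
Hypothesis cvg_heat : forall t, 0 < t -> cvgn (series (heat_term w lam t)).

Local Notation Z := (heat_sum w lam).

Variables s c : nat -> R.
Hypothesis s_decr : forall i j, (i < j)%N -> s j < s i.
Hypothesis heat_exp : forall n,
  (Z t - \sum_(i < n.+1) c i * t `^ (- s i)) / t `^ (- s n) @[t --> 0^'+] --> 0.

(** Only the terms before the [n]-th are removed, so the remainder is O of the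
    [n]-th power and not o of it. *)
Definition heat_rem n t := Z t - \sum_(i < n) c i * t `^ (- s i).

Lemma powR_expR t x : 0 < t -> t `^ x = expR (x * ln t).
Proof. by move=> t0; rewrite /powR gt_eqF. Qed.

Lemma heat_remS n t : heat_rem n t = heat_rem n.+1 t + c n * t `^ (- s n).
Proof. by rewrite /heat_rem big_ord_recr/= opprD addrA subrK. Qed.

(** Near [0] the bound is the asymptotic expansion; away from [0] both sides
    are bounded since the heat trace is monotone. *)
Lemma heat_rem_bound n : exists C, 0 <= C /\
  forall t, 0 < t <= 1 -> `|heat_rem n t| <= C * expR (- s n * ln t).
Proof.
have /cvgrPdist_lt /(_ 1 ltr01) [d /= d0 hd] := heat_exp n.
pose E i := expR (`|s i| * - ln d).
pose M := Z d + \sum_(i < n) `|c i| * E i.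
have Zd0 : 0 <= Z d by exact: (heat_sum_ge0 w0 cvg_heat).
have M0 : 0 <= M.
  by rewrite addr_ge0// sumr_ge0// => i _; rewrite mulr_ge0// expR_ge0.
have ME0 : 0 <= M * E n by rewrite mulr_ge0// expR_ge0.
exists (1 + `|c n| + M * E n); split; first by rewrite !addr_ge0.
move=> t /andP[t0 t1].
have [td|dt] := ltP t d.
  have := hd t; rewrite /ball/= sub0r normrN gtr0_norm// => /(_ td t0).
  rewrite sub0r normrN -/(heat_rem n.+1 t) powR_expR// normrM normfV.
  rewrite [`|expR _|]ger0_norm ?expR_ge0// ltr_pdivrMr ?expR_gt0// mul1r => h.
  rewrite heat_remS powR_expR// (le_trans (ler_normD _ _))//.
  rewrite [leRHS]mulrDl [X in _ <= X + _]mulrDl mul1r.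
  have ge : 0 <= M * E n * expR (- s n * ln t) by rewrite mulr_ge0// expR_ge0.
  rewrite -[leLHS]addr0 lerD// lerD//; first exact: ltW.
  by rewrite normrM [`|expR _|]ger0_norm ?expR_ge0.
have lnt : `|ln t| <= - ln d.
  rewrite ler0_norm ?ln_le0// lerN2 ler_ln// posrE//.
have Et i : expR (- s i * ln t) <= E i.
  rewrite ler_expR (le_trans (ler_norm _))// normrM normrN.
  by rewrite ler_wpM2l.
have Etn : 1 <= E n * expR (- s n * ln t).
  rewrite -expRD -expR0 ler_expR -lerBlDr sub0r.
  rewrite (le_trans (ler_norm _))// normrN normrM normrN.
  by rewrite ler_wpM2l.
apply: (@le_trans _ _ M).
  rewrite (le_trans (ler_normB _ _))// lerD//.
    have Zt0 : 0 <= Z t by exact: (heat_sum_ge0 w0 cvg_heat).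
    rewrite ger0_norm//; exact: (heat_sum_nonincr a0 w0 lama cvg_heat).
  rewrite (le_trans (ler_norm_sum _ _ _))// ler_sum// => i _.
  rewrite normrM ler_wpM2l// powR_expR// ger0_norm ?expR_ge0//.
apply: (@le_trans _ _ (M * (E n * expR (- s n * ln t)))); first by rewrite ler_peMr.
by rewrite mulrA [leRHS]mulrDl lerDr mulr_ge0 ?expR_ge0.
Qed.

Lemma measurable_heat_rem n :
  measurable_fun (`]0, 1]%classic : set (measurableTypeR R)) (heat_rem n).
Proof.
apply: measurable_funB; first exact: (measurable_heat_sum01 cvg_heat).
apply: measurable_sum => i; apply: measurable_funM => //.
by apply: measurable_funTS; exact: measurable_powR.
Qed.

Lemma mellin_weight_rem n x : s n < x -> mellin_weight `]0, 1]%classic (heat_rem n) x.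
Proof.
move=> sx; have [C [C0 hC]] := heat_rem_bound n.
have x0 : 0 < x - s n by rewrite subr_gt0.
have i : mu.-integrable `]0, 1]%classic
    (fun t => C%:E * (expR ((x - s n - 1) * ln t))%:E)%E.
  by apply: integrableZl => //; exact: integrable_power01.
apply: le_integrable i => //.
  apply/measurable_EFinP; apply: measurable_funM; last exact: measurable_heat_rem.
  apply: measurableT_comp => //; apply: measurable_funM => //.
  exact: measurable_ln_on.
move=> t /=; rewrite in_itv/= => t01; rewrite lee_fin [leRHS]normrM.
rewrite (ger0_norm C0) normrM ![`|expR _|]ger0_norm ?expR_ge0//.
have -> : (x - s n - 1) * ln t = (x - 1) * ln t + - s n * ln t by ring.
rewrite expRD mulrCA ler_wpM2l ?expR_ge0//; exact: hC.
Qed.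

(** The [n]-th term of the expansion contributes its pole. *)
Lemma mellin_remS n z : s n < Re z ->
  mellin `]0, 1]%classic (heat_rem n) z =
  mellin `]0, 1]%classic (heat_rem n.+1) z + (c n)%:C / (z - (s n)%:C).
Proof.
move=> sz.
have mI : measurable (`]0, 1]%classic : set (measurableTypeR R)) by [].
have i1 : Cintegrable mu `]0, 1]%classic
    (fun t => cpow t (z - 1) * (heat_rem n.+1 t)%:C).
  apply: Cintegrable_mellin => //; first exact: measurable_heat_rem.
  by apply: mellin_weight_rem; exact: lt_trans (s_decr (ltnSn n)) sz.
have z0 : 0 < Re (z - (s n)%:C) by rewrite cReD cReN /= subr_gt0.
have i2 := Cintegrable_power01 z0.
rewrite -(Cintegral_power01 z0) -CintegralZ// -CintegralD//; last exact: CintegrableZ.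
apply: eq_Cintegral => t /set_mem /=; rewrite in_itv/= => /andP[t0 _].
have e : (c n * t `^ (- s n))%:C = (c n)%:C * cexp (- (s n)%:C * (ln t)%:C).
  by rewrite -(rmorphN (real_complex R)) -rmorphM cexp_real powR_expR// -rmorphM.
have eD (x y : R) : (x + y)%:C = x%:C + y%:C by rewrite rmorphD.
rewrite heat_remS eD mulrDr; congr (_ + _).
rewrite e mulrCA; congr (_ * _).
by rewrite /cpow -cexpD; congr cexp; ring.
Qed.

(** The formula for the continuation on the half-plane [s n < Re z]: the first
    [n] terms of the expansion have been integrated over [0, 1] in closed
    form. *)
Definition heat_cont n z : R[i] :=
  mellin `[1, +oo[%classic Z z + mellin `]0, 1]%classic (heat_rem n) z +
  \sum_(i < n) (c i)%:C / (z - (s i)%:C).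

Lemma heat_contS n z : s n < Re z -> heat_cont n.+1 z = heat_cont n z.
Proof.
move=> sz; rewrite /heat_cont (mellin_remS sz) big_ord_recr/=.
by rewrite -!addrA; congr (_ + (_ + _)); exact: addrC.
Qed.

Lemma heat_cont_le n m z : (n <= m)%N -> s n < Re z -> heat_cont m z = heat_cont n z.
Proof.
elim: m => [|m IH]; first by rewrite leqn0 => /eqP ->.
rewrite leq_eqVlt => /predU1P[->//|]; rewrite ltnS => nm sz.
rewrite heat_contS ?IH//.
move: nm; rewrite leq_eqVlt => /predU1P[<-//|/s_decr h]; exact: lt_trans h sz.
Qed.

Lemma heat_cont_irr n m z : s n < Re z -> s m < Re z -> heat_cont m z = heat_cont n z.
Proof.
move=> sn sm; have [nm|/ltnW mn] := leqP n m; first exact: heat_cont_le.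
by apply/esym/heat_cont_le.
Qed.

Lemma mellin_weight_halfline x : s 0%N < x -> mellin_weight `]0, +oo[%classic Z x.
Proof.
move=> sx; have mZ := measurable_heat_sum cvg_heat.
have h := mellin_weight_rem sx.
have e : heat_rem 0 = Z by apply/funext => t; rewrite /heat_rem big_ord0 subr0.
rewrite e in h.
have m : measurable_fun (`]0, +oo[%classic : set (measurableTypeR R))
    (fun t => expR ((x - 1) * ln t) * Z t).
  apply: measurable_funM => //.
  apply: measurableT_comp => //; apply: measurable_funM => //.
  exact: measurable_ln_on.
by have [] := integrable_halfline m h (mellin_weight_heat_oo a0 w0 lama cvg_heat x).
Qed.

Lemma heat_cont0 z : s 0%N < Re z ->
  heat_cont 0 z = mellin `]0, +oo[%classic Z z.
Proof.
move=> sz; have mZ := measurable_heat_sum cvg_heat.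
have e : heat_rem 0 = Z by apply/funext => t; rewrite /heat_rem big_ord0 subr0.
have h := mellin_weight_rem sz; rewrite e in h.
rewrite /heat_cont big_ord0 addr0 e addrC; apply/esym.
apply: (Cintegral_halfline _ _ _).2.
- apply: CmeasurableM => //; apply: Cmeasurable_cexpM => //.
  exact: measurable_ln_on.
- by apply: Cintegrable_mellin => //; exact: (measurable_heat_sum01 cvg_heat).
- apply: Cintegrable_mellin => //; first exact: (measurable_heat_sum_oo cvg_heat).
  exact: (mellin_weight_heat_oo a0 w0 lama cvg_heat).
Qed.

End Continuation.

(** * Meromorphy and residues *)

Section RegularDerivable.
Variable K : numFieldType.
Implicit Types (F G : K -> K) (w q r : K).

Lemma derivable_regularM F G w :
  derivable (F : K^o -> K^o) w 1 -> derivable (G : K^o -> K^o) w 1 ->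
  derivable ((fun w => F w * G w) : K^o -> K^o) w 1.
Proof. by move=> dF dG; exact: derivableM. Qed.

Lemma derivable_regular_inv r q w : w != q ->
  derivable ((fun w => r / (w - q)) : K^o -> K^o) w 1.
Proof.
move=> wq; have wq0 : w - q != 0 by rewrite subr_eq0.
have d : derivable ((fun w => w - q) : K^o -> K^o) w 1.
  by apply: derivableB; [exact: derivable_id|exact: derivable_cst].
by apply: derivable_regularM; [exact: derivable_cst|exact: derivableV].
Qed.
End RegularDerivable.

Section Holomorphic.
Variable R : realType.
Implicit Types (F G : R[i] -> R[i]) (p q z : R[i]) (y : R).

Lemma near_Re_gt y p : y < Re p -> \forall w \near (p : R[i]^o), y < Re w.
Proof.
move=> yp.
have e0 : 0 < (Re p - y)%:C by rewrite ltcR subr_gt0.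
have := nbhsx_ballx (p : R[i]^o) _ e0.
apply: filterS => w; rewrite -ball_normE /= normcE ltcR => h.
have := le_lt_trans (Re_le_modulus _) h; rewrite cReD cReN.
by move=> /(le_lt_trans (ler_norm _)); lra.
Qed.

Lemma holomorphic_nearD F G p : holomorphic_near F p -> holomorphic_near G p ->
  holomorphic_near (fun w => F w + G w) p.
Proof.
by move=> hF hG; apply: filterS2 hF hG => w dF dG; exact: derivableD.
Qed.

Lemma holomorphic_near_cst q p : holomorphic_near (fun=> q) p.
Proof.
by apply: (@nearW _ (nbhs (p : R[i]^o))) => w; exact: derivable_cst.
Qed.

Lemma holomorphic_nearM F G p : holomorphic_near F p -> holomorphic_near G p ->
  holomorphic_near (fun w => F w * G w) p.
Proof.
by move=> hF hG; apply: filterS2 hF hG => w dF dG; exact: derivable_regularM.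
Qed.

Lemma holomorphic_nearB q p : holomorphic_near (fun w => w - q) p.
Proof.
apply: (@nearW _ (nbhs (p : R[i]^o))) => w.
by apply: derivableB; [exact: derivable_id|exact: derivable_cst].
Qed.

Lemma holomorphic_near_sum (I : Type) (r : seq I) (P : pred I)
    (F : I -> R[i] -> R[i]) p :
  (forall i, P i -> holomorphic_near (F i) p) ->
  holomorphic_near (fun w => \sum_(i <- r | P i) F i w) p.
Proof.
move=> hF; elim: r => [|i r IH].
  rewrite (_ : (fun w => _) = fun=> 0); first exact: holomorphic_near_cst.
  by apply/funext => w; rewrite big_nil.
case: (boolP (P i)) => Pi.
  rewrite (_ : (fun w => _) = fun w => F i w + \sum_(j <- r | P j) F j w).
    exact: (holomorphic_nearD (hF _ Pi) IH).
  by apply/funext => w; rewrite big_cons Pi.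
rewrite (_ : (fun w => _) = fun w => \sum_(j <- r | P j) F j w)//.
by apply/funext => w; rewrite big_cons (negbTE Pi).
Qed.

Lemma holomorphic_near_simple_pole q r p : p != q ->
  holomorphic_near (fun w => r / (w - q)) p.
Proof.
move=> pq.
have e0 : 0 < `|p - q| by rewrite normr_gt0 subr_eq0.
have := nbhsx_ballx (p : R[i]^o) _ e0.
apply: filterS => w; rewrite -ball_normE /= => h.
apply: derivable_regular_inv.
by apply: contraTneq h => ->; rewrite ltxx.
Qed.


End Holomorphic.

Section MeromorphicContinuation.
Variable R : realType.
Implicit Types (x t : R) (z p : R[i]).
Variables (w lam : nat -> R) (a : R).
Hypotheses (a0 : 0 < a) (w0 : forall k, 0 <= w k) (lama : forall k, a <= lam k).
Hypothesis cvg_heat : forall t, 0 < t -> cvgn (series (heat_term w lam t)).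

Local Notation Z := (heat_sum w lam).

Variables s c : nat -> R.
Hypothesis s_decr : forall i j, (i < j)%N -> s j < s i.
Hypothesis s_unbounded : forall x, exists n, s n < x.
Hypothesis heat_exp : forall n,
  (Z t - \sum_(i < n.+1) c i * t `^ (- s i)) / t `^ (- s n) @[t --> 0^'+] --> 0.

(** Any [n] with [s n < Re z] gives the same value, by [heat_cont_irr]. *)
Definition heat_continuation z : R[i] :=
  heat_cont w lam s c (sval (cid (s_unbounded (Re z)))) z.

Lemma heat_continuationE n z : s n < Re z ->
  heat_continuation z = heat_cont w lam s c n z.
Proof.
move=> sz; rewrite /heat_continuation; case: cid => m /= sm.
exact: (heat_cont_irr a0 w0 lama cvg_heat s_decr heat_exp).
Qed.

(** Near [p] both transforms are holomorphic, and so is every term of the finite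
    sum whose exponent differs from [p]. *)
Lemma heat_continuation_polar n p : s n < Re p ->
  exists h, [/\ holomorphic_near h p &
    \forall z \near (p : R[i]^o)^', heat_continuation z =
      h z + (\sum_(i < n | (s i)%:C == p) (c i)%:C) / (z - p)].
Proof.
move=> sp.
exists (fun z => mellin `[1, +oo[%classic Z z +
  mellin `]0, 1]%classic (heat_rem w lam s c n) z +
  \sum_(i < n | (s i)%:C != p) (c i)%:C / (z - (s i)%:C)); split.
  apply: holomorphic_nearD; first apply: holomorphic_nearD.
  - apply: (@nearW _ (nbhs (p : R[i]^o))) => z.
    apply: (@derivable_mellin _ _ _ (Re z - 1) (Re z + 1)) => //.
    + exact: (measurable_heat_sum_oo cvg_heat).
    + by move=> x _; exact: (mellin_weight_heat_oo a0 w0 lama cvg_heat).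
    + by rewrite ltrBlDr ltrDl ltr01.
  - have := near_Re_gt sp; apply: filterS => z sz.
    apply: (@derivable_mellin _ _ _ (s n) (Re z + 1)) => //.
    + exact: (measurable_heat_rem cvg_heat).
    + move=> x /andP[sx _].
      exact: (mellin_weight_rem a0 w0 lama cvg_heat heat_exp).
    + by rewrite sz ltrDl ltr01.
  - apply: holomorphic_near_sum => i si; apply: holomorphic_near_simple_pole.
    by rewrite eq_sym.
near=> z.
have sz : s n < Re z by near: z; apply: nbhs_dnbhs; exact: near_Re_gt.
rewrite (heat_continuationE sz) /heat_cont -!addrA; congr (_ + (_ + _)).
rewrite (bigID (fun i : 'I_n => (s i)%:C == p))/= addrC; congr (_ + _).
by rewrite mulr_suml; apply: eq_bigr => i /eqP ->.
Unshelve. all: by end_near. Qed.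

Lemma meromorphic_heat_continuation : meromorphic heat_continuation.
Proof.
move=> p; have [n sn] := s_unbounded (Re p).
have [h [hh hF]] := heat_continuation_polar sn.
set b := \sum_(i < n | _) _ in hF.
exists 1%N, (fun z => (z - p) * h z + b); split.
  apply: holomorphic_nearD; last exact: holomorphic_near_cst.
  exact: (holomorphic_nearM (holomorphic_nearB p p) hh).
near=> z.
have zp' : z != p by near: z; exact: (nbhs_dnbhs_neq (p : R[i]^o)).
have zp : z - p != 0 by rewrite subr_eq0.
rewrite expr1 mulrDl mulrAC mulfV// mul1r.
by near: z.
Unshelve. all: by end_near. Qed.

Lemma residue_heat_continuation k : is_residue heat_continuation (s k)%:C (c k)%:C.
Proof.
have sk : s k.+1 < Re (s k)%:C by exact: s_decr.
have [h [hh hF]] := heat_continuation_polar sk.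
exists 0%N, (fun=> (c k)%:C), h; split => //.
apply: filterS hF => z ->; rewrite big_ord1 expr1; congr (_ + _ / _).
rewrite (big_pred1 (ord_max : 'I_k.+1))// => i /=.
apply/eqP/eqP => [/complexI|->//].
move=> e; apply/val_inj => /=.
by have [/s_decr|/s_decr|//] := ltngtP i k; rewrite e ltxx.
Qed.

Lemma heat_continuation_zeta z : 0 < Re z -> s 0%N < Re z ->
  heat_continuation z =
  (limn (series (fun k => w k * Re (cpow (lam k) (- z)))) +i*
   limn (series (fun k => w k * Im (cpow (lam k) (- z))))) * cGamma z.
Proof.
move=> z0 sz; rewrite (heat_continuationE sz).
rewrite (heat_cont0 a0 w0 lama cvg_heat heat_exp)//.
rewrite (zeta_Gamma_mellin a0 w0 lama)//.
exact: (mellin_weight_halfline a0 w0 lama cvg_heat heat_exp).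
Qed.

End MeromorphicContinuation.

(** * Smoothed traces *)

Section Regularization.
Variable R : realType.
Notation mu := (@lebesgue_measure R).
Implicit Types (x y t u L : R).
Variables (w lam : nat -> R) (a : R).
Hypotheses (a0 : 0 < a) (w0 : forall k, 0 <= w k) (lama : forall k, a <= lam k).
Hypothesis cvg_heat : forall t, 0 < t -> cvgn (series (heat_term w lam t)).

Local Notation Z := (heat_sum w lam).

(** [cutoff y] is [e] times the integral of [expR (- u) * expR (- u * y)] over
    [u >= 1], hence a superposition of the heat weights. *)
Definition cutoff y := expR (- y) / (1 + y).

Let scaled x := fun k => x * lam k.

Lemma heat_term_scaled x t k : heat_term w (scaled x) t k = heat_term w lam (x * t) k.
Proof. by rewrite /heat_term /scaled !mulNr mulrA (mulrC t). Qed.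

(** Dilating time amounts to dilating the spectrum, so that all that is known of
    heat sums applies to [fun u => Z (x * u)]. *)
Lemma heat_sum_scaled x t : heat_sum w (scaled x) t = Z (x * t).
Proof.
by rewrite /heat_sum; congr (limn (series _)); apply/funext => k; exact: heat_term_scaled.
Qed.

Lemma cvg_heat_scaled x : 0 < x ->
  forall t, 0 < t -> cvgn (series (heat_term w (scaled x) t)).
Proof.
move=> x0 t t0; have := cvg_heat (mulr_gt0 x0 t0).
by congr (cvgn (series _)); apply/funext => k; rewrite heat_term_scaled.
Qed.

Lemma measurable_heat_sum_scaled x : 0 < x ->
  measurable_fun (`[1, +oo[%classic : set (measurableTypeR R)) (fun u => Z (x * u)).
Proof.
move=> x0; have -> : (fun u => Z (x * u)) = heat_sum w (scaled x).
  by apply/funext => u; rewrite heat_sum_scaled.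
exact: (measurable_heat_sum_oo (cvg_heat_scaled x0)).
Qed.

Lemma integrable_cutoff x : 0 < x ->
  mu.-integrable `[1, +oo[%classic (EFin \o (fun u => expR (- u) * Z (x * u))).
Proof.
move=> x0.
have [i _] := integral_expR_oo 1 (@ltr01 R).
have i' : mu.-integrable `[1, +oo[%classic (fun u => (Z x)%:E * (expR (- 1 * u))%:E)%E.
  by exact: integrableZl.
apply: le_integrable i' => //.
  apply/measurable_EFinP; apply: measurable_funM; last exact: measurable_heat_sum_scaled.
  by apply/measurable_funTS; exact: measurableT_comp.
move=> u /=; rewrite in_itv/= andbT => u1; have u0 : 0 < u by exact: lt_le_trans u1.
have Zx : 0 <= Z x by exact: (heat_sum_ge0 w0 cvg_heat).
have Zxu : 0 <= Z (x * u) by apply: (heat_sum_ge0 w0 cvg_heat); exact: mulr_gt0.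
rewrite lee_fin !normrM !ger0_norm ?expR_ge0// mulN1r mulrC ler_wpM2r ?expR_ge0//.
by apply: (heat_sum_nonincr a0 w0 lama cvg_heat) => //; rewrite ler_peMr// ltW.
Qed.

(** Integration of the series of [Z (x * u)] against [expR (- u)]. *)
Lemma series_cutoff x : 0 < x ->
  series (fun k => w k * cutoff (x * lam k)) @ \oo -->
  expR 1 * \int[mu]_(u in `[1, +oo[) (expR (- u) * Z (x * u)).
Proof.
move=> x0.
have mI : measurable (`[1, +oo[%classic : set (measurableTypeR R)) by [].
have mF k : measurable_fun (`[1, +oo[%classic : set (measurableTypeR R))
    (fun t => heat_term w (scaled x) t k).
  by apply: measurable_funTS; exact: measurable_heat_term.
have F0 k t : `[1, +oo[%classic t -> 0 <= heat_term w (scaled x) t k.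
  by move=> _; exact: heat_term_ge0.
have cF t : `[1, +oo[%classic t ->
    series (fun k => heat_term w (scaled x) t k) @ \oo --> Z (x * t).
  rewrite /= in_itv/= andbT => t1; rewrite -heat_sum_scaled.
  by apply: heat_sum_cvg; [exact: cvg_heat_scaled|exact: lt_le_trans t1].
have mh : measurable_fun (`[1, +oo[%classic : set (measurableTypeR R))
    (fun u => expR (- u)).
  by apply: measurable_funTS; exact: measurableT_comp.
have [_ h] := @Rintegral_series _ _ R mu _ mI (fun k t => heat_term w (scaled x) t k)
  (fun u => expR (- u)) (fun u => Z (x * u)) mF F0 cF mh (integrable_cutoff x0).
set I := \int[mu]_(t in _) _ in h *.
have {}h : expR 1 * series (fun k => \int[mu]_(t in `[1, +oo[)
    (expR (- t) * heat_term w (scaled x) t k)) n @[n --> \oo] --> expR 1 * I.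
  by apply: cvgMr.
apply: cvg_trans h; apply: near_eq_cvg; apply: nearW => n.
rewrite /series/= big_distrr; apply: eq_bigr => k _ /=.
have b0 : 0 < 1 + x * lam k.
  by rewrite ltr_wpDr// mulr_ge0// ltW// (lam_gt0 a0 lama).
have [i J] := integral_expR_oo 1 b0.
rewrite [X in _ * X](_ : _ = w k * (expR (- (1 + x * lam k) * 1) / (1 + x * lam k))).
  rewrite /cutoff mulrCA; congr (_ * _); rewrite mulr1 mulrA -expRD.
  by congr (expR _ / _); ring.
rewrite -J -RintegralZl//; apply: eq_Rintegral => u _.
rewrite /heat_term /scaled mulrCA -expRD; congr (_ * expR _); ring.
Qed.

Variables (s0 c0 c1 : R).
Hypothesis heat_exp1 :
  (Z t - (c0 * t `^ (- s0) + c1 * t `^ (1 - s0))) / t `^ (1 - s0) @[t --> 0^'+] --> 0.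

(** The power [2 `^ s0] makes the leading terms of the two heat sums cancel, and
    the next term survives with the coefficient [2 - 1]. *)
Definition balanced t := expR ((s0 - 1) * ln t) * (2 `^ s0 * Z (2 * t) - Z t).

Lemma balanced_cvg : balanced t @[t --> 0^'+] --> c1.
Proof.
pose e t := (Z t - (c0 * t `^ (- s0) + c1 * t `^ (1 - s0))) / t `^ (1 - s0).
have e2 : e (2 * t) @[t --> 0^'+] --> 0.
  apply/cvg_at_rightP => v [v0 vc]; move/cvg_at_rightP : heat_exp1; apply; split.
    by move=> n; rewrite mulr_gt0.
  by rewrite -[X in _ --> X](mulr0 2); apply: cvgMr.
have h : c1 + 2 * e (2 * t) - e t @[t --> 0^'+] --> c1.
  have e22 : 2 * e (2 * t) @[t --> 0^'+] --> (2 * 0 : R) by exact: cvgMr.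
  have c1c : (fun=> c1) @ (0 : R)^'+ --> c1 by exact: cvg_cst.
  have := cvgB (cvgD c1c e22) heat_exp1.
  by rewrite mulr0 addr0 subr0; exact.
apply: cvg_trans h; apply: near_eq_cvg; near=> t.
have t0 : 0 < t by near: t; exact: nbhs_right_gt.
have t20 : 0 < 2 * t by rewrite mulr_gt0.
(* The expansion with its error term solved for [Z]. *)
have ZE r : 0 < r -> Z r = expR (- s0 * ln r) * (c0 + (c1 + e r) * r).
  move=> r0; rewrite /e !powR_expR//.
  have -> : (1 - s0) * ln r = ln r + - s0 * ln r by ring.
  rewrite expRD lnK ?posrE//.
  by field; rewrite !gt_eqF// expR_gt0.
rewrite /balanced (ZE t)// (ZE (2 * t))// lnM ?posrE// (powR_expR s0 (t := 2))//.
have E1 : expR (s0 * ln 2) * expR (- s0 * ln 2) = 1 by rewrite -expRD mulNr addrN expR0.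
have E2 : expR ((s0 - 1) * ln t) * expR (- s0 * ln t) = t^-1.
  rewrite -expRD -[RHS](lnK (x := t^-1)) ?posrE ?invr_gt0//; congr expR.
  by rewrite lnV ?posrE//; ring.
rewrite (mulrDr (- s0)) expRD; move: (e t) (e (2 * t)) => et e2t.
have -> : expR ((s0 - 1) * ln t) *
   (expR (s0 * ln 2) * (expR (- s0 * ln 2) * expR (- s0 * ln t) *
     (c0 + (c1 + e2t) * (2 * t))) - expR (- s0 * ln t) * (c0 + (c1 + et) * t)) =
  (expR ((s0 - 1) * ln t) * expR (- s0 * ln t)) *
   ((expR (s0 * ln 2) * expR (- s0 * ln 2)) * (c0 + (c1 + e2t) * (2 * t)) -
     (c0 + (c1 + et) * t)) by ring.
rewrite E1 E2 mul1r; field; by rewrite gt_eqF.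
Unshelve. all: by end_near. Qed.

(** Near [0] by convergence, at infinity by the exponential decay of the heat
    trace. *)
Lemma balanced_bounded : exists C, forall t, 0 < t -> `|balanced t| <= C.
Proof.
have /cvgrPdist_lt /(_ 1 ltr01) [d /= d0 hd] := balanced_cvg.
(* With this [e], the term [e * t] in the bound of [ln t] is absorbed by the
   exponential decay. *)
pose p := s0 - 1; pose e := a / (`|p| + 1).
have p1 : 0 < `|p| + 1 by rewrite ltr_wpDl.
have e0 : 0 < e by rewrite divr_gt0.
pose K := expR (`|p| * (`|ln e| + `|ln d|)).
pose M := (2 `^ s0 + 1) * (Z d * expR (a * d)).
have Zd0 : 0 <= Z d by exact: (heat_sum_ge0 w0 cvg_heat).
have M0 : 0 <= M by rewrite !mulr_ge0 ?expR_ge0// addr_ge0// powR_ge0.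
have K0 : 0 <= K by exact: expR_ge0.
exists (`|c1| + 1 + K * M) => t t0.
have [td|dt] := ltP t d.
  have := hd t; rewrite /ball/= sub0r normrN gtr0_norm// => /(_ td t0) h.
  have -> : balanced t = c1 - (c1 - balanced t) by ring.
  rewrite (le_trans (ler_normB _ _))//.
  by have := mulr_ge0 K0 M0; lra.
have Zt0 : 0 <= Z t by exact: (heat_sum_ge0 w0 cvg_heat).
have Z2t : Z (2 * t) <= Z t.
  by apply: (heat_sum_nonincr a0 w0 lama cvg_heat) => //; rewrite ler_peMl ?ler1n// ltW.
have Z2t0 : 0 <= Z (2 * t) by apply: (heat_sum_ge0 w0 cvg_heat); rewrite mulr_gt0.
have Ztd := heat_sum_decay w0 lama cvg_heat d0 dt.
apply: (@le_trans _ _ (K * M)); last by rewrite lerDr addr_ge0.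
rewrite /balanced normrM ger0_norm ?expR_ge0//.
have h1 : `|2 `^ s0 * Z (2 * t) - Z t| <= (2 `^ s0 + 1) * Z t.
  rewrite (le_trans (ler_normB _ _))// normrM [`|2 `^ s0|]ger0_norm ?powR_ge0//.
  by rewrite !ger0_norm// [leRHS]mulrDl mul1r lerD2r ler_wpM2l// powR_ge0.
apply: (@le_trans _ _ (expR (p * ln t) * (M * expR (- a * t)))).
  have e1 : 0 <= 2 `^ s0 + 1 by rewrite addr_ge0// powR_ge0.
  apply: ler_wpM2l; first exact: expR_ge0.
  by apply: (le_trans h1); rewrite /M -[leRHS]mulrA; exact: ler_wpM2l.
rewrite mulrCA (mulrC K) ler_wpM2l// -expRD ler_expR.
have h2 : `|ln t| <= e * t + (`|ln e| + `|ln d|).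
  have := ln_le_linear e0 t0; have := ler_norm (- ln e); have := ler_norm (- ln d).
  rewrite !normrN; have : ln d <= ln t by rewrite ler_ln ?posrE.
  have := mulr_gt0 e0 t0; have := normr_ge0 (ln e); have := normr_ge0 (ln d).
  by rewrite ler_norml => *; apply/andP; split; lra.
have h3 : p * ln t <= `|p| * (e * t + (`|ln e| + `|ln d|)).
  by rewrite (le_trans (ler_norm _))// normrM ler_wpM2l.
have h4 : `|p| * (e * t) <= a * t.
  rewrite mulrA ler_wpM2r ?(ltW t0)// /e mulrCA ler_piMr ?(ltW a0)//.
  by rewrite ler_pdivrMr// mul1r lerDl.
by rewrite mulrDr in h3; lra.
Qed.

End Regularization.

(** * The limit over the whole spectrum *)

Section RegularizedLimit.
Variable R : realType.
Notation mu := (@lebesgue_measure R).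
Implicit Types (x y t u L l : R).

Lemma cutoff_bound y : 0 <= y -> 0 <= cutoff y <= expR (- y).
Proof.
move=> y0; have y1 : 0 < 1 + y by rewrite ltr_wpDr.
rewrite /cutoff divr_ge0 ?expR_ge0 ?(ltW y1)//=.
by rewrite ler_pdivrMr// ler_peMr ?expR_ge0// lerDl.
Qed.

(** [ln L <= c * L - ln c] for every [c > 0]. *)
Lemma epsilon_cvg0 : @epsilon R L @[L --> +oo] --> (0 : R)^'+.
Proof.
move=> A [d /= d0 hA].
have e0 : 0 < d / 4 by rewrite divr_gt0.
suff : \forall L \near +oo%R, A (epsilon (L : R)) by [].
near=> L.
have L1 : 1 < L by near: L; apply: nbhs_pinfty_gt; exact: num_real.
have L0 : 0 < L by exact: lt_trans L1.
have eps0 : 0 < epsilon L by rewrite /epsilon divr_gt0// mulr_gt0// ln_gt0.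
apply: hA => //=; rewrite sub0r normrN gtr0_norm//.
have h := ln_le_linear e0 L0.
have h2 : - (4 * ln (d / 4)) / d < L by near: L; apply: nbhs_pinfty_gt; exact: num_real.
rewrite ltr_pdivrMr// in h2.
rewrite /epsilon ltr_pdivrMr//; lra.
Unshelve. all: by end_near. Qed.

Lemma upper_Gamma_expR p : upper_Gamma (p + 1) 1 =
  \int[mu]_(u in `[1, +oo[) (expR (p * ln u) * expR (- u)).
Proof.
apply: eq_Rintegral => u /set_mem /=; rewrite in_itv/= andbT => u1.
by rewrite addrK powR_expR// (lt_le_trans _ u1).
Qed.

Lemma integrable_power_expRN p :
  mu.-integrable `[1, +oo[%classic (EFin \o (fun u => expR (p * ln u) * expR (- u))).
Proof.
have := integrable_power_expR p (@ltr01 R).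
by rewrite (_ : (fun t => _) = fun u => expR (p * ln u) * expR (- u))//;
  apply/funext => u; rewrite mulN1r.
Qed.

Lemma upper_Gamma_gt0 p : 0 < upper_Gamma (p + 1 : R) 1.
Proof.
rewrite upper_Gamma_expR; apply: Rintegral_power_expR_gt0 => //.
  by apply: subset_itvl; rewrite bnd_simp.
exact: integrable_power_expRN.
Qed.

Variables (w lam : nat -> R) (a : R).
Hypotheses (a0 : 0 < a) (w0 : forall k, 0 <= w k) (lama : forall k, a <= lam k).
Hypothesis cvg_heat : forall t, 0 < t -> cvgn (series (heat_term w lam t)).

Local Notation Z := (heat_sum w lam).

Variables (s0 c0 c1 C : R).
Hypothesis heat_exp1 :
  (Z t - (c0 * t `^ (- s0) + c1 * t `^ (1 - s0))) / t `^ (1 - s0) @[t --> 0^'+] --> 0.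
Hypothesis heat_bound : forall t, 0 < t <= 1 -> Z t <= C * expR (- s0 * ln t).

Definition cutoff_pair x l := 2 `^ s0 * cutoff (2 * x * l) - cutoff (x * l).

Lemma cutoff_pair_bound x l : 0 < x -> 0 < l ->
  `|cutoff_pair x l| <= (2 `^ s0 + 1) * expR (- x * l).
Proof.
move=> x0 l0; have xl : 0 < x * l by exact: mulr_gt0.
have /andP[h1 h2] := cutoff_bound (ltW xl).
have xl2 : 0 <= 2 * x * l by rewrite -mulrA mulr_ge0// ltW.
have /andP[h3 h4] := cutoff_bound xl2.
have h5 : expR (- (2 * x * l)) <= expR (- (x * l)) by rewrite ler_expR; lra.
rewrite /cutoff_pair (le_trans (ler_normB _ _))// normrM !ger0_norm ?powR_ge0//.
rewrite [leRHS]mulrDl mul1r mulNr lerD// ler_wpM2l ?powR_ge0//.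
exact: le_trans h4 h5.
Qed.

Let eC := expR 1 * upper_Gamma (2 - s0) 1.

Lemma series_cutoff_pair x : 0 < x ->
  series (fun k => w k * cutoff_pair x (lam k)) @ \oo -->
  expR 1 * \int[mu]_(u in `[1, +oo[)
    (expR (- u) * (2 `^ s0 * Z (2 * x * u) - Z (x * u))).
Proof.
move=> x0; have x20 : 0 < 2 * x by rewrite mulr_gt0.
have h1 := series_cutoff a0 w0 lama cvg_heat x20.
have h2 := series_cutoff a0 w0 lama cvg_heat x0.
have i1 := integrable_cutoff a0 w0 lama cvg_heat x20.
have i2 := integrable_cutoff a0 w0 lama cvg_heat x0.
have i3 : mu.-integrable `[1, +oo[%classic
    (EFin \o (fun u => 2 `^ s0 * (expR (- u) * Z (2 * x * u)))).
  have : mu.-integrable `[1, +oo[%classic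
    (fun u => (2 `^ s0)%:E * (expR (- u) * Z (2 * x * u))%:E)%E.
    by exact: integrableZl.
  by apply: eq_integrable.
rewrite (_ : \int[mu]_(u in _) _ =
  2 `^ s0 * \int[mu]_(u in `[1, +oo[) (expR (- u) * Z (2 * x * u)) -
  \int[mu]_(u in `[1, +oo[) (expR (- u) * Z (x * u))); last first.
  rewrite -RintegralZl// -RintegralB//; apply: eq_Rintegral => u _.
  by rewrite mulrBr mulrCA.
have h3 : 2 `^ s0 * series (fun k => w k * cutoff (2 * x * lam k)) n @[n --> \oo] -->
    2 `^ s0 * (expR 1 * \int[mu]_(u in `[1, +oo[) (expR (- u) * Z (2 * x * u))).
  by apply: cvgMr; exact: h1.
have h := cvgB h3 h2.
rewrite mulrBr mulrCA; apply: cvg_trans (h _); apply: near_eq_cvg; apply: nearW => n.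
rewrite !fctE /series/= big_distrr/= -sumrB; apply: eq_bigr => k _.
by rewrite /cutoff_pair mulrBr mulrCA.
Qed.

(** Rescaled by the power of [x], the integrand becomes the bounded function
    [balanced], and dominated convergence applies. *)
Lemma cutoff_pair_limit :
  expR ((s0 - 1) * ln x) / eC *
    limn (series (fun k => w k * cutoff_pair x (lam k))) @[x --> 0^'+] --> c1.
Proof.
have G0 : 0 < upper_Gamma (2 - s0) 1.
  by rewrite (_ : 2 - s0 = 1 - s0 + 1) ?upper_Gamma_gt0//; ring.
have eC0 : 0 < eC by rewrite mulr_gt0// expR_gt0.
pose g u := expR ((1 - s0) * ln u) * expR (- u).
have GE : upper_Gamma (2 - s0) 1 = \int[mu]_(u in `[1, +oo[) g u.
  by rewrite (_ : 2 - s0 = 1 - s0 + 1) ?upper_Gamma_expR//; ring.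
have ig : mu.-integrable `[1, +oo[%classic (EFin \o g) by exact: integrable_power_expRN.
have [B hB] := balanced_bounded a0 w0 lama cvg_heat heat_exp1.
pose J x := \int[mu]_(u in `[1, +oo[) (g u * balanced w lam s0 (x * u)).
have mI : measurable (`[1, +oo[%classic : set (measurableTypeR R)) by [].
have mg : measurable_fun (`[1, +oo[%classic : set (measurableTypeR R)) g.
  by apply/measurable_EFinP; exact: measurable_int ig.
have JE x : 0 < x -> expR ((s0 - 1) * ln x) / eC *
    limn (series (fun k => w k * cutoff_pair x (lam k))) =
    (upper_Gamma (2 - s0) 1)^-1 * J x.
  move=> x0; rewrite (cvg_lim _ (series_cutoff_pair x0))//.
  have -> : J x = expR ((s0 - 1) * ln x) * \int[mu]_(u in `[1, +oo[)
      (expR (- u) * (2 `^ s0 * Z (2 * x * u) - Z (x * u))).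
    have i1 := integrable_cutoff a0 w0 lama cvg_heat (mulr_gt0 (ltr0Sn R 1) x0).
    have i2 := integrable_cutoff a0 w0 lama cvg_heat x0.
    have i3 : mu.-integrable `[1, +oo[%classic
        (fun u => (2 `^ s0)%:E * (expR (- u) * Z (2 * x * u))%:E)%E.
      by apply: integrableZl => //; exact: i1.
    have i4 : mu.-integrable `[1, +oo[%classic (EFin \o
        (fun u => expR (- u) * (2 `^ s0 * Z (2 * x * u) - Z (x * u)))).
      apply: (eq_integrable mI _ _ _ (integrableB mI i3 i2)) => u _ /=.
      by rewrite -EFinM -EFinB mulrBr (mulrCA (2 `^ s0)).
    rewrite -(RintegralZl _ mI i4).
    apply: eq_Rintegral => u /set_mem /=; rewrite in_itv/= andbT => u1.
    have u0 : 0 < u by exact: lt_le_trans u1.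
    rewrite /g /balanced lnM ?posrE// (mulrDr (s0 - 1)) expRD (mulrA 2).
    have E : expR ((1 - s0) * ln u) * expR ((s0 - 1) * ln u) = 1.
      by rewrite -expRD -mulrDl addrC addrA subrK subrr mul0r expR0.
    set b := 2 `^ s0 * _ - _; set p1 := expR ((1 - s0) * _) in E *.
    set p2 := expR ((s0 - 1) * ln u) in E *.
    set p3 := expR (- u); set p4 := expR ((s0 - 1) * ln x).
    by transitivity ((p1 * p2) * (p4 * (p3 * b))); [ring|rewrite E mul1r].
  rewrite /eC; field; rewrite !gt_eqF// expR_gt0//.
suff JC : J x @[x --> 0^'+] --> c1 * upper_Gamma (2 - s0) 1.
  have h : (upper_Gamma (2 - s0) 1)^-1 * J x @[x --> 0^'+] -->
      (upper_Gamma (2 - s0) 1)^-1 * (c1 * upper_Gamma (2 - s0) 1) by exact: cvgMr.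
  rewrite mulrCA mulVf ?gt_eqF// mulr1 in h.
  apply: cvg_trans h; apply: near_eq_cvg; near=> x.
  by rewrite JE//; near: x; exact: nbhs_right_gt.
apply/cvg_at_rightP => v [v0 vc].
have mb n : measurable_fun (`[1, +oo[%classic : set (measurableTypeR R))
    (fun u => balanced w lam s0 (v n * u)).
  have mZ x : 0 < x -> measurable_fun (`[1, +oo[%classic : set (measurableTypeR R))
    (fun u => Z (x * u)) by move=> x0; exact: (measurable_heat_sum_scaled cvg_heat).
  apply: measurable_funM.
    apply: measurableT_comp => //; apply: measurable_funM => //.
    apply: measurableT_comp; first exact: measurable_ln.
    by apply: measurable_funM.
  apply: measurable_funB; last exact: mZ.
  apply: measurable_funM => //.
  have mZ2 := mZ (2 * v n) (mulr_gt0 (ltr0Sn R 1) (v0 n)).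
  rewrite (_ : (fun u => _) = fun u => Z (2 * v n * u)); first exact: mZ2.
  by apply/funext => u; rewrite mulrA.
have := @Rintegral_dominated_cvg _ _ R mu _ mI
  (fun n u => g u * balanced w lam s0 (v n * u)) (fun u => c1 * g u)
  (fun u => B * g u).
case.
- by move=> n; exact: measurable_funM.
- move=> u /=; rewrite in_itv/= andbT => u1; rewrite (mulrC c1); apply: cvgMr.
  have u0 : 0 < u by exact: lt_le_trans u1.
  have := (cvg_at_rightP _ _ _).1 (balanced_cvg heat_exp1).
  apply; split; first by move=> n; rewrite mulr_gt0.
  by rewrite -[X in _ --> X](mul0r u); apply: cvgMl.
- have : mu.-integrable `[1, +oo[%classic (fun u => B%:E * (g u)%:E)%E.
    by exact: integrableZl.
  by apply: eq_integrable.
- move=> n u /=; rewrite in_itv/= andbT => u1.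
  have u0 : 0 < u by exact: lt_le_trans u1.
  have gu : 0 <= g u by rewrite mulr_ge0// expR_ge0.
  by rewrite normrM (ger0_norm gu) mulrC ler_wpM2r// hB// mulr_gt0.
by move=> _; rewrite RintegralZl// -GE.
Unshelve. all: by end_near. Qed.

End RegularizedLimit.

(** * The limit over the truncated spectrum *)

Section TruncatedLimit.
Variable R : realType.
Implicit Types (x y t u L l : R).
Variables (w lam : nat -> R) (a : R).
Hypotheses (a0 : 0 < a) (w0 : forall k, 0 <= w k) (lama : forall k, a <= lam k).
Hypothesis cvg_heat : forall t, 0 < t -> cvgn (series (heat_term w lam t)).

Local Notation Z := (heat_sum w lam).

Variables (s0 c0 c1 C : R).
Hypothesis heat_exp1 :
  (Z t - (c0 * t `^ (- s0) + c1 * t `^ (1 - s0))) / t `^ (1 - s0) @[t --> 0^'+] --> 0.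
Hypothesis heat_bound : forall t, 0 < t <= 1 -> Z t <= C * expR (- s0 * ln t).

Let pair x k := w k * cutoff_pair s0 x (lam k).
Let head x L k := w k * (if lam k <= L then cutoff_pair s0 x (lam k) else 0).
Let tail x L k := w k * (if lam k <= L then 0 else cutoff_pair s0 x (lam k)).
Let K := 2 `^ s0 + 1.

Let K_ge0 : 0 <= K.
Proof. by rewrite addr_ge0// powR_ge0. Qed.

Lemma cvg_series_dominated (u : nat -> R) x M : 0 < x ->
  (forall k, `|u k| <= M * heat_term w lam x k) ->
  [/\ cvgn (series u), cvgn [normed series u] &
      `|limn (series u)| <= M * Z x].
Proof.
move=> x0 hu; have c := heat_sum_cvg cvg_heat x0.
have cM : series (fun k => M * heat_term w lam x k) @ \oo --> M * Z x.
  have h : M * series (heat_term w lam x) n @[n --> \oo] --> M * Z x.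
    by apply: cvgMr; exact: c.
  apply: cvg_trans h; apply: near_eq_cvg; apply: nearW => n.
  by rewrite /series/= big_distrr.
have cM' : cvgn (series (fun k => M * heat_term w lam x k)).
  by apply/cvg_ex; exists (M * Z x); exact: cM.
have cN : cvgn [normed series u].
  apply: (series_le_cvg _ _ hu cM') => k //=; exact: le_trans (hu k).
split=> //; first exact: normed_cvg.
apply: (le_trans (lim_series_norm cN)).
by rewrite -(cvg_lim _ cM)//; apply: lim_series_le.
Qed.

(** All three series are dominated by the heat series at time [x]. *)
Lemma head_tail x L : 0 < x ->
  limn (series (head x L)) = limn (series (pair x)) - limn (series (tail x L)).
Proof.
move=> x0.
have b k : `|cutoff_pair s0 x (lam k)| <= K * expR (- x * lam k).
  by apply: cutoff_pair_bound => //; exact: (lam_gt0 a0 lama).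
have b0 k : 0 <= K * expR (- x * lam k) by rewrite mulr_ge0// expR_ge0.
have dom (v : nat -> R) : (forall k, `|v k| <= K * expR (- x * lam k)) ->
    cvgn (series (fun k => w k * v k)).
  move=> hv; have [] // := @cvg_series_dominated (fun k => w k * v k) x K x0 _.
  move=> k; rewrite normrM (ger0_norm (w0 k)) /heat_term mulrCA.
  by rewrite ler_wpM2l.
have cp : cvgn (series (pair x)) by exact: dom.
have ct : cvgn (series (tail x L)).
  by apply: dom => k; case: ifP => // _; rewrite normr0.
rewrite -lim_seriesB//; congr (limn (series _)); apply/funext => k.
by rewrite /head /tail /pair /= -[RHS]mulrBr; case: ifP => _; rewrite ?subr0 ?subrr.
Qed.

(** Beyond [L] half of the exponent already supplies a factor [L^-1]; this is
    the reason for the factor [2 * ln L] in [epsilon]. *)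
Lemma tail_bound L : 1 < L ->
  `|limn (series (tail (epsilon L) L))| <= K / L * Z (epsilon L / 2).
Proof.
move=> L1; have L0 : 0 < L by exact: lt_trans L1.
have x0 : 0 < epsilon L by rewrite /epsilon divr_gt0// mulr_gt0// ln_gt0.
have x20 : 0 < epsilon L / 2 by rewrite divr_gt0.
have [] // := @cvg_series_dominated (tail (epsilon L) L) _ (K / L) x20 _.
move=> k; rewrite /tail normrM (ger0_norm (w0 k)) /heat_term mulrCA ler_wpM2l//.
have KL : 0 <= K / L by rewrite divr_ge0// ltW.
have [_|Ll] := leP (lam k) L; first by rewrite normr0 mulr_ge0// expR_ge0.
have l0 := lam_gt0 a0 lama k.
rewrite (le_trans (cutoff_pair_bound _ x0 l0))// -mulrA ler_wpM2l//.
have -> : - epsilon L * lam k = - (epsilon L / 2 * lam k) + - (epsilon L / 2) * lam k.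
  by field.
rewrite expRD ler_wpM2r ?expR_ge0//.
rewrite -[leRHS](lnK (x := L^-1)) ?posrE ?invr_gt0// lnV ?posrE// ler_expR lerN2.
have -> : ln L = epsilon L / 2 * L by rewrite /epsilon; field; rewrite gt_eqF.
by rewrite ler_wpM2l ?ltW.
Qed.

Lemma truncated_limit :
  epsilon L `^ (s0 - 1) / (expR 1 * upper_Gamma (2 - s0) 1) *
    limn (series (head (epsilon L) L)) @[L --> +oo] --> c1.
Proof.
set eC := expR 1 * _.
have G0 : 0 < upper_Gamma (2 - s0) 1.
  by rewrite (_ : 2 - s0 = 1 - s0 + 1) ?upper_Gamma_gt0//; ring.
have eC0 : 0 < eC by rewrite mulr_gt0// expR_gt0.
pose A x := expR ((s0 - 1) * ln x) / eC * limn (series (pair x)).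
have cA : A (epsilon L) @[L --> +oo] --> c1.
  apply: (cvg_comp _ _ (@epsilon_cvg0 R)).
  exact: (cutoff_pair_limit a0 w0 lama cvg_heat heat_exp1).
pose B L := expR ((s0 - 1) * ln (epsilon L)) / eC * limn (series (tail (epsilon L) L)).
pose M := K * C * expR (s0 * ln 2) / 2 / eC.
have eps_le1 : \forall L \near +oo, @epsilon R L <= 1.
  have h : \forall x \near (0 : R)^'+, x <= 1 by exact: nbhs_right_le.
  exact: (epsilon_cvg0 h).
have lnM : M / ln L @[L --> +oo] --> 0.
  apply/cvgrPdist_le => e e0; near=> L.
  have L1 : 1 < L by near: L; apply: nbhs_pinfty_gt; exact: num_real.
  have L0 : 0 < L by exact: lt_trans L1.
  have l0 : 0 < ln L by exact: ln_gt0.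
  have hL : expR (`|M| / e) <= L.
    by near: L; apply: nbhs_pinfty_ge; exact: num_real.
  rewrite sub0r normrN normrM [`|_^-1|]gtr0_norm ?invr_gt0// ler_pdivrMr//.
  by rewrite mulrC -ler_pdivrMr// -ler_expR lnK ?posrE.
have cB : B L @[L --> +oo] --> 0.
  apply/norm_cvg0P; apply: (squeeze_cvgr _ (cvg_cst 0) lnM).
  near=> L; rewrite normr_ge0/=.
  have L1 : 1 < L by near: L; apply: nbhs_pinfty_gt; exact: num_real.
  have L0 : 0 < L by exact: lt_trans L1.
  have l0 : 0 < ln L by exact: ln_gt0.
  have x1 : epsilon L <= 1 by near: L.
  have x0 : 0 < epsilon L by rewrite /epsilon divr_gt0// mulr_gt0.
  have x20 : 0 < epsilon L / 2 <= 1 by apply/andP; split; lra.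
  rewrite /B normrM ger0_norm; last by rewrite divr_ge0 ?expR_ge0// ltW.
  have h : `|limn (series (tail (epsilon L) L))| <=
      K / L * (C * expR (- s0 * ln (epsilon L / 2))).
    rewrite (le_trans (tail_bound L1))// ler_wpM2l ?heat_bound//.
    by rewrite divr_ge0// ltW.
  apply: (le_trans (ler_wpM2l _ h)); first by rewrite divr_ge0 ?expR_ge0// ltW.
  have E : expR ((s0 - 1) * ln (epsilon L)) * expR (- s0 * ln (epsilon L / 2)) =
      expR (s0 * ln 2) * (epsilon L)^-1.
    rewrite -expRD -[(epsilon L)^-1]lnK ?posrE ?invr_gt0// -expRD; congr expR.
    by rewrite ln_div ?posrE// lnV ?posrE//; ring.
  rewrite le_eqVlt; apply/orP; left; apply/eqP.
  transitivity (expR ((s0 - 1) * ln (epsilon L)) * expR (- s0 * ln (epsilon L / 2))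
    * (K * C / L / eC)); first by ring.
  by rewrite E /epsilon /M; field; rewrite !gt_eqF.
have h := cvgB cA cB; rewrite subr0 in h.
apply: cvg_trans (h _); apply: near_eq_cvg.
near=> L.
have L1 : 1 < L by near: L; apply: nbhs_pinfty_gt; exact: num_real.
have x0 : 0 < epsilon L.
  by rewrite /epsilon divr_gt0 ?(lt_trans _ L1)// mulr_gt0// ln_gt0.
by rewrite !fctE /A /B head_tail// powR_expR// mulrBr.
Unshelve. all: by end_near. Qed.

End TruncatedLimit.

(** * Sums over the spectrum *)

Section DiscreteSums.
Variable R : realType.

(** The inequality of Markov for the counting measure. *)
Lemma finite_superlevel (A : set R) (f : R -> R) (e : R) :
  0 < e -> (forall i, A i -> 0 <= f i) -> (\esum_(i in A) (f i)%:E < +oo)%E ->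
  finite_set (A `&` [set i | e <= f i]).
Proof.
move=> e0 f0 fin; apply: contrapT => /infiniteP/pcard_leP/injfunPex[/= q q_fun q_inj].
have qA k : A (q k) /\ e <= f (q k) by exact: q_fun.
have s0 : (0 <= \esum_(i in A) (f i)%:E)%E.
  by apply: esum_ge0 => i Ai; rewrite lee_fin f0.
pose r := fine (\esum_(i in A) (f i)%:E).
have rE : (\esum_(i in A) (f i)%:E = r%:E)%E by rewrite fineK// ge0_fin_numE.
pose n := (Num.truncn (r / e)).+1.
have : ((e *+ n)%:E <= r%:E)%E.
  rewrite -rE; apply: (@le_trans _ _ (\esum_(i in q @` setT) (f i)%:E)%E); last first.
    rewrite [leLHS]esum_mkcond [leRHS]esum_mkcond; apply: le_esum => i _.
    case: ifPn => [/set_mem[k _ <-]|_]; first by rewrite mem_set//; exact: (qA k).1.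
    by case: ifPn => // /set_mem Ai; rewrite lee_fin f0.
  rewrite esum_image// -nneseries_esumT; last first.
    by move=> k; rewrite lee_fin f0//; exact: (qA k).1.
  apply: (le_trans _ (nneseries_lim_ge n _)) => [|k _ _]; last first.
    by rewrite lee_fin f0//; exact: (qA k).1.
  rewrite sumEFin lee_fin -[n in leLHS]subn0 -sumr_const_nat.
  by apply: ler_sum => k _; exact: (qA k).2.
rewrite lee_fin leNgt => /negP; apply.
rewrite -mulr_natl -ltr_pdivrMr//.
exact: truncnS_gt.
Qed.

Lemma summable_support_countable (A : set R) (f : R -> R) :
  (forall i, A i -> 0 <= f i) -> (\esum_(i in A) (f i)%:E < +oo)%E ->
  countable (A `&` [set i | f i != 0]).
Proof.
move=> f0 fin.
rewrite [X in countable X](_ : _ =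
    \bigcup_n (A `&` [set i | n.+1%:R^-1 <= f i])); last first.
  apply/seteqP; split => i /=.
    move=> [Ai fi]; have fi0 : 0 < f i by rewrite lt_neqAle eq_sym fi f0.
    have [n _ hn] := @near_infty_natSinv_lt R (PosNum fi0).
    by exists n => //; split => //=; rewrite ltW//; exact: (hn n (leqnn n)).
  move=> [n _ [Ai /= h]]; split => //; rewrite gt_eqF//.
  by rewrite (lt_le_trans _ h)// invr_gt0.
apply: bigcup_countable => // n _; apply: finite_set_countable.
exact: finite_superlevel.
Qed.

Lemma finite_set_pos_lower (A : set R) : finite_set A ->
  (forall x, A x -> 0 < x) -> exists2 b, 0 < b & forall x, A x -> b <= x.
Proof.
move=> finA A0; have : forall s : seq R, exists2 b, 0 < b &
    forall x, x \in s -> 0 < x -> b <= x.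
  elim=> [|y s [b b0 hb]]; first by exists 1.
  have [y0|y0] := ltP 0 y; last first.
    exists b => // x; rewrite inE => /predU1P[->|/hb//]; by rewrite ltNge y0.
  exists (Num.min y b); first by rewrite lt_min y0.
  by move=> x; rewrite inE ge_min => /predU1P[->|xs x0]; rewrite ?lexx// hb ?orbT.
move=> /(_ (finmap.enum_fset (fset_set A)))[b b0 hb]; exists b => // x Ax; apply: hb; last exact: A0.
by rewrite in_fset_set//; exact: mem_set.
Qed.

Lemma nneseries_seriesE (u : nat -> R) : (forall k, 0 <= u k) -> cvgn (series u) ->
  (\sum_(k <oo) (u k)%:E = (limn (series u))%:E)%E.
Proof.
move=> u0 c; rewrite -EFin_lim//; apply: congr_lim; apply/funext => n /=.
by rewrite /series/= sumEFin.
Qed.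

Lemma nneseries_series (u : nat -> R) : (forall k, 0 <= u k) ->
  (\sum_(k <oo) (u k)%:E < +oo)%E <-> cvgn (series u).
Proof.
move=> u0; split; first exact: nnseries_is_cvg.
by move=> c; rewrite nneseries_seriesE// ltry.
Qed.

End DiscreteSums.

Section Spectrum.
Variables (R : realType) (H : completeNormedModType R[i]).
Variables (ip : {dot H for @Num.conj R[i]}) (D : operator H).

(** The first vector of a basis of the eigenspace. *)
Lemma eigenvector l : multiplicity D l != 0%N ->
  exists2 x : H, x != 0 & eigenspace D l x.
Proof.
rewrite /multiplicity; case: xgetP => [n _ [e [E free]] n0|]; last by rewrite eqxx.
case: n e E free n0 => [//|n] e E free _.
pose d (i : 'I_n.+1) : R[i] := (i == ord0)%:R.
have eE : e ord0 = \sum_i d i *: e i.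
  rewrite (bigD1 ord0)//= /d eqxx scale1r big1 ?addr0// => i /negbTE ->.
  by rewrite scale0r.
exists (e ord0); last by rewrite E; exists d.
apply/negP => /eqP e0.
have /free/(_ ord0) : \sum_i d i *: e i = 0 by rewrite -eE.
by rewrite /d eqxx => /eqP; rewrite oner_eq0.
Qed.

(** On an eigenvector [x] the form takes the value [l] times the square of the
    norm, so [0 <= l]; and [l = 0] would put [x] in the kernel of an invertible
    operator. *)
Lemma eigenvalue_gt0 l : is_inner_product ip -> positive ip D -> invertible D ->
  multiplicity D l != 0%N -> 0 < l.
Proof.
move=> hip pos [S [_ hS _]] /eigenvector[x x0 [dx Dx]].
have n0 : 0 < `|x| ^+ 2 by rewrite exprn_gt0// normr_gt0.
have : 0 <= l.
  have := pos x dx; rewrite Dx linearZl_LR /= hip pmulr_lge0// => h.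
  by move: h; rewrite -ler0c.
rewrite le_eqVlt => /predU1P[l0|//].
have op0 : op D 0 = 0.
  have := @op_linear R H D 1 0 0 (dom0 D) (dom0 D).
  rewrite !scale1r addr0 => /eqP; rewrite -subr_eq0 opprD addrA subrr sub0r oppr_eq0.
  by move/eqP.
have h0 := hS 0 (dom0 D); have hx := hS x dx.
rewrite op0 scale0r subr0 in h0.
rewrite Dx -l0 !scale0r subr0 h0 in hx.
by rewrite -hx eqxx in x0.
Qed.

End Spectrum.

(** * Traces as series *)

Section TraceSeries.
Variables (R : realType) (H : completeNormedModType R[i]) (D : operator H).
Implicit Types (f G : R -> R) (l L : R).

Local Notation spec := (real_spectrum D).
Local Notation m := (multiplicity D).

Hypothesis spec_gt0 : forall l, m l != 0%N -> 0 < l.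
Hypothesis heat_trace_class : forall t, 0 < t -> trace_class D (fun l => expR (- t * l)).

Let heat_fin t : 0 < t -> (\esum_(l in spec) ((m l)%:R * expR (- t * l))%:E < +oo)%E.
Proof.
move=> t0; have := heat_trace_class t0; rewrite /trace_class /summable.
rewrite (eq_esum (b := fun l => ((m l)%:R * expR (- t * l))%:E))// => l _.
by rewrite /= ger0_norm// mulr_ge0// expR_ge0.
Qed.

(** Each such eigenvalue contributes at least [expR (- L)] to the heat trace at
    time [1]. *)
Lemma finite_spectrum_upto L : finite_set (spec `&` [set l | m l != 0%N /\ l <= L]).
Proof.
have := @finite_superlevel R spec (fun l => (m l)%:R * expR (- 1 * l)) (expR (- L))
  (expR_gt0 _) _ (heat_fin ltr01).
move=> /(_ (fun l _ => mulr_ge0 (ler0n _ _) (expR_ge0 _))).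
apply: sub_finite_set => l [sl [/= ml lL]]; split => //=.
rewrite mulN1r -[leLHS]mul1r ler_pM ?expR_ge0//.
  by rewrite ler1n lt0n.
by rewrite ler_expR lerN2.
Qed.

(** The eigenvalues with multiplicities as a pair of sequences; the default
    value of [lam] is harmless since the corresponding weight vanishes. *)
Lemma spectrum_enumeration : exists (w lam : nat -> R) (a : R),
  [/\ 0 < a, forall k, 0 <= w k, forall k, a <= lam k &
    forall f, (forall l, 0 <= f l) ->
      (\esum_(l in spec) ((m l)%:R * f l)%:E = \sum_(k <oo) (w k * f (lam k))%:E)%E].
Proof.
pose S := spec `&` [set l | m l != 0%N].
have cS : countable S.
  have := @summable_support_countable R spec (fun l => (m l)%:R * expR (- 1 * l))
    (fun l _ => mulr_ge0 (ler0n _ _) (expR_ge0 _)) (heat_fin ltr01).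
  congr (countable _); rewrite /S; congr (_ `&` _); apply/seteqP; split => l /=;
    by rewrite mulf_eq0 negb_or pnatr_eq0 (gt_eqF (expR_gt0 _)) ?andbT.
have [b b0 hb] := finite_set_pos_lower (finite_spectrum_upto 1)
  (fun l h => spec_gt0 h.2.1).
pose a := Num.min b 1.
have a0 : 0 < a by rewrite lt_min b0 ltr01.
have aS l : S l -> a <= l.
  move=> [sl ml]; have [l1|/ltW l1] := leP l 1.
    by rewrite ge_min hb.
  by rewrite ge_min l1 orbT.
have /countable_bijP[B SB] := cS.
rewrite card_eq_sym in SB; have /card_set_bijP[e eB] := SB.
have eS k : B k -> S (e k) by case: eB => + _ _; apply.
exists (fun k => if k \in B then (m (e k))%:R else 0),
  (fun k => if k \in B then e k else a), a; split=> //.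
- by move=> k; case: ifP.
- by move=> k; case: ifPn => // /set_mem /eS /aS.
- move=> f f0.
  have mf0 l : (0 <= ((m l)%:R * f l)%:E)%E by rewrite lee_fin mulr_ge0.
  transitivity (\esum_(l in S) ((m l)%:R * f l)%:E)%E.
    rewrite /S esum_mkcondr; apply: eq_esum => l _.
    case: ifPn => //; rewrite notin_setE /= => /negP; rewrite negbK => /eqP ->.
    by rewrite mul0r.
  rewrite (@reindex_esum R _ _ B S e _ eB) esum_mkcond nneseries_esumT; last first.
    by move=> k; case: ifP => _; rewrite ?mul0r// lee_fin mulr_ge0.
  by apply: eq_esum => k _; case: ifP => _; rewrite ?mul0r.
Qed.

Variables (w lam : nat -> R).
Hypothesis w0 : forall k, 0 <= w k.
Hypothesis enum : forall f, (forall l, 0 <= f l) ->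
  (\esum_(l in spec) ((m l)%:R * f l)%:E = \sum_(k <oo) (w k * f (lam k))%:E)%E.

Lemma trace_class_series G :
  trace_class D G <-> cvgn (series (fun k => w k * `|G (lam k)|)).
Proof.
rewrite /trace_class /summable (eq_esum (b := fun l => ((m l)%:R * `|G l|)%:E)); last first.
  by move=> l _; rewrite /= normrM ger0_norm.
rewrite (enum (f := fun l => `|G l|))//.
by apply: nneseries_series => k; rewrite mulr_ge0.
Qed.

Lemma trace_series G : cvgn (series (fun k => w k * `|G (lam k)|)) ->
  trace D G = limn (series (fun k => w k * G (lam k))).
Proof.
move=> c.
have c1 : cvgn (series (fun k => w k * Num.max (G (lam k)) 0)).
  apply: series_le_cvg c => k; rewrite ?mulr_ge0 ?le_max ?lexx ?orbT//.
  by rewrite ler_wpM2l// ge_max ler_norm normr_ge0.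
have c2 : cvgn (series (fun k => w k * Num.max (- G (lam k)) 0)).
  apply: series_le_cvg c => k; rewrite ?mulr_ge0 ?le_max ?lexx ?orbT//.
  by rewrite ler_wpM2l// ge_max -normrN ler_norm normr_ge0.
rewrite /trace (enum (f := fun l => Num.max (G l) 0)); last first.
  by move=> l; rewrite le_max lexx orbT.
rewrite (enum (f := fun l => Num.max (- G l) 0)); last first.
  by move=> l; rewrite le_max lexx orbT.
rewrite nneseries_seriesE//; last by move=> k; rewrite mulr_ge0// le_max lexx orbT.
rewrite nneseries_seriesE//; last by move=> k; rewrite mulr_ge0// le_max lexx orbT.
rewrite /= -lim_seriesB//; congr (limn (series _)); apply/funext => k /=.
rewrite !fctE -mulrBr; congr (_ * _).
case: (leP 0 (G (lam k))) => g0.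
  by rewrite (max_idPr _) ?subr0// oppr_le0.
by rewrite (max_idPl _) ?sub0r ?opprK// oppr_ge0 ltW.
Qed.

(** Both sides reduce to a sum over the finite set of eigenvalues of positive
    multiplicity up to [L]. *)
Lemma trace_uptoE L G :
  trace_upto D L G = trace D (fun l => if l <= L then G l else 0).
Proof.
pose A := spec `&` [set l | m l != 0%N /\ l <= L].
have finA : finite_set A := finite_spectrum_upto L.
rewrite /trace_upto -(fsbig_widen A); last 2 first.
- move=> l [sl [ml lL]]; split => //=; rewrite in_itv/= lL andbT.
  exact: spec_gt0.
- move=> l [[sl /=]]; rewrite in_itv/= => /andP[_ lL] nA /=.
  have [->|ml] := eqVneq (m l) 0%N; first by rewrite mul0r.
  by exfalso; apply: nA.
have part (g : R -> R) : (forall l, 0 <= g l) ->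
    fine (\esum_(l in spec) ((m l)%:R * (if l <= L then g l else 0))%:E)%E =
    \sum_(l \in A) (m l)%:R * g l.
  move=> g0.
  have -> : (\esum_(l in spec) ((m l)%:R * (if l <= L then g l else 0))%:E =
      \esum_(l in A) ((m l)%:R * g l)%:E)%E.
    rewrite /A [RHS]esum_mkcondr; apply: eq_esum => l _.
    have [lL|lL] := boolP (l <= L); last first.
      case: ifPn; last by rewrite mulr0.
      by move=> /set_mem /= [_]; rewrite (negbTE lL).
    case: ifPn => //; rewrite notin_setE /= => h.
    have [->|ml] := eqVneq (m l) 0%N; first by rewrite mul0r.
    by exfalso; apply: h.
  rewrite esum_fset//; last by move=> l _; rewrite lee_fin mulr_ge0.
  by rewrite fsumEFin.
have maxE (g : R -> R) : (fun l => ((m l)%:R * Num.max (if l <= L then g l else 0) 0)%:E)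
   = (fun l => ((m l)%:R * (if l <= L then Num.max (g l) 0 else 0))%:E).
  by apply/funext => l; case: ifP => // _; rewrite maxxx.
rewrite /trace maxE.
have -> : (fun l => ((m l)%:R * Num.max (- (if l <= L then G l else 0)) 0)%:E) =
  (fun l => ((m l)%:R * Num.max (if l <= L then - G l else 0) 0)%:E).
  by apply/funext => l; case: ifP => // _; rewrite oppr0.
rewrite maxE !part; try by move=> l; rewrite le_max lexx orbT.
rewrite !fsbig_finite//= -sumrB; apply: eq_bigr => l _.
rewrite -mulrBr; congr (_ * _).
case: (leP 0 (G l)) => g0.
  by rewrite (max_idPr _) ?subr0// oppr_le0.
by rewrite (max_idPl _) ?sub0r ?opprK// oppr_ge0 ltW.
Qed.

End TraceSeries.

(** * The residue as a limit of truncated traces *)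

(** The distances [s0 - s i] define a strictly increasing map of [nat] onto itself,
    which is the identity. *)
Lemma decreasing_enumeration (R : realType) (s : nat -> R) (s0 : R) :
  (forall i j, (i < j)%N -> s j < s i) ->
  [set s0 - k%:R | k in [set: nat]] = range s -> forall i, s i = s0 - i%:R.
Proof.
move=> s_decr E.
have le_s i j : s i <= s j -> (j <= i)%N.
  by rewrite leqNgt => h; apply/negP => /s_decr; rewrite ltNge h.
have kex i : exists k, s i = s0 - k%:R.
  have : range s (s i) by exists i.
  by rewrite -E => -[k _ <-]; exists k.
pose k i := sval (cid (kex i)).
have kE i : s i = s0 - (k i)%:R by rewrite /k; case: cid.
have k_incr i j : (i < j)%N -> (k i < k j)%N.
  by move=> /s_decr; rewrite !kE ltrD2l ltrN2 ltr_nat.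
have k_ge i : (i <= k i)%N.
  by elim: i => // i IH; exact: leq_ltn_trans IH (k_incr _ _ (ltnSn i)).
suff kid i : k i = i by move=> i; rewrite kE kid.
elim/ltn_ind: i => i IH.
have [j kj] : exists j, k j = i.
  have : [set s0 - k%:R | k in [set: nat]] (s0 - i%:R) by exists i.
  rewrite E => -[j _ sj]; exists j; apply/eqP; rewrite -(eqr_nat R); apply/eqP.
  by move: sj; rewrite kE => /addrI/oppr_inj.
have : (j <= i)%N by rewrite -kj.
rewrite leq_eqVlt => /predU1P[ji|ji]; first by rewrite -[in LHS]ji.
by have := ji; rewrite -kj (IH _ ji) ltnn.
Qed.

Theorem corollary2p11 (R : realType) (H : completeNormedModType R[i])
    (ip : {dot H for @Num.conj R[i]}) (hip : is_inner_product ip)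
    (D : operator H) (hD : spectrally_elliptic ip D)
    (s0 s1 : R) (hs : heat_spectrum D [set s0 - k%:R | k in [set: nat]])
    (hs1 : s1 = s0 - 1) :
  exists (F : R[i] -> R[i]) (r : R),
    [/\ zeta_Gamma_continuation D F,
        is_residue F s1%:C r%:C
      & epsilon L `^ (s0 - 1) / (expR 1 * upper_Gamma (2 - s0) 1) *
        trace_upto D L (fun l =>
          2 `^ s0 * expR (- 2 * l * epsilon L) / (1 + 2 * l * epsilon L)
          - expR (- l * epsilon L) / (1 + l * epsilon L))
          @[L --> +oo] --> r].
Proof.
have [[_ pos inv] _ _ _] := hD.
have [s [c [[htc s_decr hexp] hrange]]] := hs.
have spec_gt0 l : multiplicity D l != 0%N -> 0 < l.
  exact: (eigenvalue_gt0 hip pos inv).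
have [w [lam [a [a0 w0 lama enum]]]] := spectrum_enumeration spec_gt0 htc.
have sE := decreasing_enumeration s_decr hrange.
have cvg_heat t : 0 < t -> cvgn (series (heat_term w lam t)).
  move=> t0; have /(trace_class_series w0 enum) := htc t t0.
  by congr (cvgn (series _)); apply/funext => k; rewrite ger0_norm// expR_ge0.
have traceE t : 0 < t -> heat_trace D t = heat_sum w lam t.
  move=> t0; apply: (trace_series w0 enum).
  exact: ((trace_class_series w0 enum _).1 (htc t t0)).
have heat_exp n :
    (heat_sum w lam t - \sum_(i < n.+1) c i * t `^ (- s i)) / t `^ (- s n)
      @[t --> 0^'+] --> 0.
  apply: cvg_trans (hexp n); apply: near_eq_cvg; near=> x.
  by rewrite traceE//; near: x; exact: nbhs_right_gt.
have s_unbounded x : exists n, s n < x.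
  exists (Num.truncn (s0 - x)).+1; rewrite sE ltrBlDr addrC -ltrBlDr.
  exact: truncnS_gt.
have s00 : s 0%N = s0 by rewrite sE subr0.
have s11 : s 1%N = s1 by rewrite sE hs1.
exists (heat_continuation w lam c s_unbounded), (c 1%N); split.
- split; first exact: (meromorphic_heat_continuation a0 w0 lama cvg_heat).
  exists (Num.max 0 s0); first by rewrite le_max lexx.
  move=> z; rewrite gt_max => /andP[z0 zs].
  have wz : mellin_weight `]0, +oo[%classic (heat_sum w lam) (complex.Re z).
    by apply: (mellin_weight_halfline a0 w0 lama cvg_heat heat_exp); rewrite s00.
  have [n1 n2] := cvg_zeta_norm a0 w0 lama cvg_heat z0 wz.
  split; first by split; apply/(trace_class_series w0 enum).
  rewrite (heat_continuation_zeta a0 w0 lama cvg_heat s_decr s_unbounded heat_exp)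
    ?s00//.
  by rewrite /zeta /ctrace !(trace_series w0 enum).
- rewrite -s11; exact: (residue_heat_continuation a0 w0 lama cvg_heat).
have [C [_ hC]] := heat_rem_bound a0 w0 lama cvg_heat heat_exp 0.
have hbound t : 0 < t <= 1 -> heat_sum w lam t <= C * expR (- s0 * ln t).
  move=> /hC; rewrite /heat_rem big_ord0 subr0 s00; apply: le_trans.
  exact: ler_norm.
have hexp1 : (heat_sum w lam t - (c 0%N * t `^ (- s0) + c 1%N * t `^ (1 - s0))) /
    t `^ (1 - s0) @[t --> 0^'+] --> 0.
  have := heat_exp 1%N; under eq_fun do rewrite !big_ord_recr big_ord0 /= add0r.
  by rewrite s00 s11 hs1 opprB.
have lim := truncated_limit a0 w0 lama cvg_heat hexp1 hbound.
apply: cvg_trans lim; apply: near_eq_cvg; near=> L.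
have L1 : 1 < L by near: L; apply: nbhs_pinfty_gt; exact: num_real.
have L0 : 0 < L by exact: lt_trans L1.
have x0 : 0 < epsilon L by rewrite /epsilon divr_gt0// mulr_gt0// ln_gt0.
have pairE l : cutoff_pair s0 (epsilon L) l =
    2 `^ s0 * expR (- 2 * l * epsilon L) / (1 + 2 * l * epsilon L)
    - expR (- l * epsilon L) / (1 + l * epsilon L).
  rewrite /cutoff_pair /cutoff mulrA.
  have -> : - (2 * epsilon L * l) = - 2 * l * epsilon L by ring.
  have -> : - (epsilon L * l) = - l * epsilon L by ring.
  by rewrite (mulrAC 2) (mulrC (epsilon L) l).
congr (_ * _); rewrite (trace_uptoE spec_gt0 htc).
rewrite (trace_series w0 enum).
  by congr (limn (series _)); apply/funext => k; congr (_ * _); case: ifP.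
have b k : `|w k * (if lam k <= L then cutoff_pair s0 (epsilon L) (lam k) else 0)| <=
    (2 `^ s0 + 1) * heat_term w lam (epsilon L) k.
  rewrite normrM (ger0_norm (w0 k)) /heat_term mulrCA ler_wpM2l//.
  have K0 : 0 <= 2 `^ s0 + 1 by rewrite addr_ge0// powR_ge0.
  case: ifP => _; last by rewrite normr0 mulr_ge0// expR_ge0.
  by apply: cutoff_pair_bound => //; exact: (lam_gt0 a0 lama).
have [_ cN _] := cvg_series_dominated cvg_heat x0 b.
move: cN; congr (cvgn (series _)); apply/funext => k;
  rewrite [LHS]normrM (ger0_norm (w0 k)); congr (_ * `|_|); case: ifP => // _;
  exact: pairE.
Unshelve. all: by end_near. Qed.
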